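(* Let $(\mathbf{X}_n)_{n\in\mathbb{Z}_+}$ be an inhomogeneous $d$-type Galton--Watson process with immigration (GWI process) with offspring mean matrices $\mathbf{B}_n$ and immigration mean vectors $\mathbf{m}_n$, such that both the offspring and the immigration have Bernoulli distribution. Suppose that: (B1) $\lim_{n\to\infty}\mathbf{B}_n=\mathbf{B}$ for some matrix $\mathbf{B}$; (B2) there is $n_0$ such that $\|\mathbf{B}_n\|\le 1$ and $\mathbf{B}-\mathbf{B}_n$ is invertible for all $n\ge n_0$; (B3) $\lim_{n\to\infty}\|\mathbf{B}_{[j,n]}\|=0$ for any fixed $j$; (B4) $\lim_{n\to\infty}\sum_{j=1}^n(\mathbf{B}-\mathbf{B}_j)\mathbf{B}_{[j,n]}=\mathbf{A}$ for some matrix $\mathbf{A}$; (B5) $\sup_n\sum_{j=1}^n\|(\mathbf{B}-\mathbf{B}_j)\mathbf{B}_{[j,n]}\|<\infty$; (M) $\lim_{n\to\infty}\mathbf{m}_n(\mathbf{B}-\mathbf{B}_n)^{-1}=\boldsymbol{\lambda}$ for some vector $\boldsymbol{\lambda}$. Then $$\mathbf{X}_n\stackrel{\mathcal{D}}{\longrightarrow}\mathrm{Po}(\boldsymbol{\lambda}\mathbf{A})\qquad (n\to\infty).$$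
   Context: Elements of $\mathbb{R}^d$ are row vectors; $\mathbf{e}_1,\dots,\mathbf{e}_d$ is the standard basis. $\|\cdot\|$ is an arbitrary norm on $\mathbb{R}^d$, and for a real $d\times d$ matrix $\|\mathbf{A}\|=\sup_{\|\mathbf{x}\|\le1}\|\mathbf{x}\mathbf{A}\|$; the statement means that if the hypotheses hold for some such norm then the conclusion holds. Inhomogeneous $d$-type GWI process: $\mathbf{X}_0=\mathbf{0}$ and $\mathbf{X}_n=\sum_{i=1}^d\sum_{j=1}^{X_{n-1,i}}\boldsymbol{\xi}_{n,j,i}+\boldsymbol{\varepsilon}_n$ for $n\in\mathbb{N}=\{1,2,\dots\}$, where $\mathbf{X}_n=(X_{n,1},\dots,X_{n,d})$ and $\{\boldsymbol{\xi}_{n,j,i},\boldsymbol{\varepsilon}_n: n,j\in\mathbb{N},\,1\le i\le d\}$ are independent random vectors with values in $\mathbb{Z}_+^d$ such that for each $n,i$ the vectors $\boldsymbol{\xi}_{n,j,i}$, $j\in\mathbb{N}$, are identically distributed. All offspring and immigration means are finite. $\mathbf{B}_n\in\mathbb{R}_+^{d\times d}$ is the matrix whose $i$-th row is $\mathsf{E}\boldsymbol{\xi}_{n,1,i}$, and $\mathbf{m}_n=\mathsf{E}\boldsymbol{\varepsilon}_n$. $\mathbf{B}_{[j,n]}=\mathbf{B}_{j+1}\mathbf{B}_{j+2}\cdots\mathbf{B}_n$ for $0\le j\le n-1$, and $\mathbf{B}_{[n,n]}=\mathbf{I}$ (identity matrix). For $\mathbf{p}=(p_1,\dots,p_d)\in[0,1]^d$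 with $p_1+\dots+p_d\le1$, $\mathrm{Be}(\mathbf{p})$ is the distribution on $\{\mathbf{0},\mathbf{e}_1,\dots,\mathbf{e}_d\}$ giving mass $p_i$ to $\mathbf{e}_i$ and $1-\sum_ip_i$ to $\mathbf{0}$. ''Bernoulli offspring'' means that $\boldsymbol{\xi}_{n,1,i}$ has law $\mathrm{Be}(\mathbf{e}_i\mathbf{B}_n)$ for all $n,i$; ''Bernoulli immigration'' means that $\boldsymbol{\varepsilon}_n$ has law $\mathrm{Be}(\mathbf{m}_n)$ for all $n$. $\mathrm{Po}(\boldsymbol{\mu})=\mathrm{Po}(\mu_1)\times\dots\times\mathrm{Po}(\mu_d)$ for $\boldsymbol{\mu}=(\mu_1,\dots,\mu_d)\in[0,\infty)^d$ (independent Poisson components). $\stackrel{\mathcal{D}}{\longrightarrow}$ is convergence in distribution. *)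

(* Defs.v *)
From HB Require Import structures.
From mathcomp Require Import all_boot all_order all_algebra finmap.
From mathcomp Require Import all_classical all_reals all_analysis.

Set Implicit Arguments.
Unset Strict Implicit.
Unset Printing Implicit Defensive.

Import Order.TTheory GRing.Theory Num.Theory.
Import numFieldNormedType.Exports.

Local Open Scope classical_set_scope.
Local Open Scope ring_scope.

HB.instance Definition _ (d : nat) := @isMeasurable.Build default_measure_display
  'rV[nat]_d discrete_measurable discrete_measurable0
  discrete_measurableC discrete_measurableU.

Section norms.
Context {R : realType} {d : nat}.

Definition is_norm (N : 'rV[R]_d -> R) : Prop :=
  [/\ forall x y, N (x + y) <= N x + N y,
      forall a x, N (a *: x) = `|a| * N x
    & forall x, N x = 0 -> x = 0].

Definition opnorm (N : 'rV[R]_d -> R) (A : 'M[R]_d) : R :=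
  sup [set N (x *m A) | x in [set x | N x <= 1]].

(* B_[j,n] = B_(j+1) * ... * B_n; the product is empty for j = n. *)
Definition mxprod (B : nat -> 'M[R]_d) (j n : nat) : 'M[R]_d :=
  \big[mulmx/1%:M]_(j.+1 <= k < n.+1) B k.

End norms.

Section independence.
Context {dT dE : measure_display} {T : measurableType dT}
  {E : measurableType dE} {R : realType}.
Local Open Scope ereal_scope.

Definition mutually_independent (P : probability T R) (I : choiceType)
    (D : set I) (V : I -> {RV P >-> E}) : Prop :=
  forall (J : {fset I}) (A : I -> set E), [set` J] `<=` D ->
    (forall i, measurable (A i)) ->
    P (\bigcap_(i in [set` J]) (V i @^-1` A i)) =
    \prod_(i <- J) P (V i @^-1` A i).

End independence.

Section esum_helpers.
Local Open Scope ereal_scope.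

Lemma esumZl (R : realType) (I : choiceType) (D : set I) (a : I -> \bar R)
  (c : R) : (0 <= c)%R -> (forall i, 0 <= a i) ->
  \esum_(i in D) (c%:E * a i) = c%:E * \esum_(i in D) a i.
Proof.
move=> c0 a0.
have le (b : I -> \bar R) (e : R) : (0 <= e)%R -> (forall i, 0 <= b i) ->
    \esum_(i in D) (e%:E * b i) <= e%:E * \esum_(i in D) b i.
  move=> e0 b0; apply: ge_ereal_sup => _ [Y [finY YD] <-].
  rewrite -ge0_mule_fsumr//; apply: lee_wpmul2l; first by rewrite lee_fin.
  by apply: esum_ge; exists Y.
apply/eqP; rewrite eq_le le//=.
have [->|cn0] := eqVneq c 0%R.
  by rewrite mul0e esum_ge0// => i _; rewrite mul0e.
have {cn0 c0}c0 : (0 < c)%R by rewrite lt0r cn0.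
rewrite -lee_pdivlMl//.
have := le (fun i => c%:E * a i) c^-1%R.
have ca0 i : 0 <= c%:E * a i by rewrite mule_ge0// lee_fin ltW.
rewrite invr_ge0 ltW// => /(_ erefl ca0).
apply: le_trans; rewrite le_eqVlt; apply/orP; left; apply/eqP.
by apply: eq_esum => i _; rewrite muleA -EFinM mulVf ?gt_eqF// mul1e.
Qed.

Lemma poisson_prob_esum (R : realType) (r : R) (A : set nat) :
  poisson_prob r 0 A = \esum_(n in A) poisson_prob r 0 [set n].
Proof.
rewrite /poisson_prob; case: ifPn => r0.
  by apply: eq_esum => n _; rewrite esum_set1// lee_fin poisson_pmf_ge0.
have [A0|A0] := pselect (A 0%N).
  rewrite (esumID [set 0%N])// setIC.
  have -> : [set 0%N] `&` A = [set 0%N].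
    by apply/seteqP; split=> [n []|n ->].
  rewrite esum_set1// [X in _ + X]esum1 ?adde0.
    by rewrite !diracE !mem_set.
  by move=> n [_ n0]; rewrite diracE memNset// => /esym.
rewrite esum1 ?diracE ?memNset// => n An; rewrite diracE memNset//.
by move=> /= n0; apply: A0; rewrite n0.
Qed.

Lemma esum_rV_prod (R : realType) (d : nat) (f : 'I_d -> nat -> \bar R) (A : 'I_d -> set nat) :
  (forall i n, 0 <= f i n) -> (forall i n, f i n \is a fin_num) ->
  (forall i, \esum_(n in A i) f i n \is a fin_num) ->
  \esum_(k in [set k : 'rV[nat]_d | forall i, A i (k ord0 i)])
     \prod_(i < d) f i (k ord0 i) = \prod_(i < d) \esum_(n in A i) f i n.
Proof.
elim: d f A => [|d IH] f A f0 f_fin fin.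
  rewrite big_ord0 [X in esum X](_ : _ = [set (0%R : 'rV[nat]_0)]).
    by rewrite esum_set1 big_ord0.
  apply/seteqP; split=> k //= _; last by case.
  by apply/matrixP => i [].
pose Q := [set k : 'rV[nat]_d | forall i, A (lift ord0 i) (k ord0 i)].
pose e (x : 'rV[nat]_d * nat) : 'rV[nat]_d.+1 :=
  (row_mx (const_mx x.2 : 'rV_1) x.1 : 'rV_(1 + d)).
have e0 x : e x ord0 ord0 = x.2.
  transitivity ((const_mx x.2 : 'rV_1) ord0 (ord0 : 'I_1)); last by rewrite mxE.
  rewrite -(row_mxEl (const_mx x.2 : 'rV_1) x.1).
  by apply: f_equal; exact/val_inj.
have eS x i : e x ord0 (lift ord0 i) = x.1 ord0 i.
  rewrite -(row_mxEr (const_mx x.2 : 'rV_1) x.1 ord0 i).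
  by apply: f_equal; exact/val_inj.
rewrite (reindex_esum (Q `*`` (fun=> A ord0)) _ e); last first.
  split.
  - move=> x [/= Qx Ax] i; case: (unliftP ord0 i) => [j|] ->.
    + by rewrite eS; exact: Qx.
    + by rewrite e0.
  - move=> x y _ _ xy; case: x xy => x1 x2; case: y => y1 y2 xy.
    congr pair; last by have := e0 (x1, x2); rewrite xy e0.
    by apply/rowP => i; have := eS (x1, x2) i; rewrite xy eS.
  - move=> k /= Ak; exists (\row_i k ord0 (lift ord0 i), k ord0 ord0) => /=.
      by split=> [i|] /=; [rewrite mxE; exact: Ak|exact: Ak].
    apply/rowP => i; case: (unliftP ord0 i) => [j|] ->.
    + by rewrite eS/= mxE.
    + by rewrite e0.
pose g (k : 'rV[nat]_d) (n : nat) := f ord0 n * \prod_(i < d) f (lift ord0 i) (k ord0 i).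
rewrite (eq_esum (b := fun x => g x.1 x.2)); last first.
  move=> x _; rewrite big_ord_recl e0; congr (_ * _).
  by apply: eq_bigr => i _; rewrite eS.
have p0 (k : 'rV[nat]_d) : 0 <= \prod_(i < d) f (lift ord0 i) (k ord0 i).
  exact: prode_ge0.
rewrite -(@esum_esum _ _ _ Q (fun=> A ord0) g); last first.
  by move=> k n _ _; rewrite mule_ge0.
rewrite big_ord_recl -IH//.
rewrite -/Q -(fineK (fin ord0)) -esumZl//; last first.
  by rewrite fine_ge0// esum_ge0.
rewrite (fineK (fin ord0)).
apply: eq_esum => k Qk; rewrite [RHS]muleC.
have pfin : \prod_(i < d) f (lift ord0 i) (k ord0 i) \is a fin_num.
  by apply: prode_fin_num.
rewrite -(fineK pfin) -esumZl//; last exact: fine_ge0.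
by apply: eq_esum => n _; rewrite /g fineK// muleC.
Qed.

End esum_helpers.

Section laws.
Context {R : realType} {d : nat}.
Local Open Scope ereal_scope.

(* A probability exactly when p is a subprobability vector; in particular a
   random vector can have law Be p only for such p. *)
Definition Be (p : 'rV[R]_d) (A : set 'rV[nat]_d) : \bar R :=
  \sum_(i < d) (p ord0 i)%:E * \d_(delta_mx ord0 i) A
  + (1 - \sum_(i < d) p ord0 i)%:E * \d_(0%R : 'rV[nat]_d) A.

(* [poisson_prob r k] is the Poisson measure of rate r (the Dirac measure at 0
   when r <= 0); its argument k is a dummy. *)
Definition Po (mu : 'rV[R]_d) (A : set 'rV[nat]_d) : \bar R :=
  \esum_(k in A) \prod_(i < d) poisson_prob (mu ord0 i) 0 [set k ord0 i].

Lemma Po_mass_ge0 (mu : 'rV[R]_d) (k : 'rV[nat]_d) :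
  0 <= \prod_(i < d) poisson_prob (mu ord0 i) 0 [set k ord0 i].
Proof. by apply: prode_ge0 => i _; exact: measure_ge0. Qed.

Let Po0 mu : Po mu set0 = 0. Proof. exact: esum_set0. Qed.

Let Po_ge0 mu A : 0 <= Po mu A.
Proof. by apply: esum_ge0 => k _; exact: Po_mass_ge0. Qed.

Let Po_sigma_additive mu : semi_sigma_additive (Po mu).
Proof.
move=> F mF tF mUF; rewrite /Po; apply: cvg_toP.
  apply: ereal_nondecreasing_is_cvgn => a b ab.
  by apply: lee_sum_nneg_natr => // n _ _; exact: Po_ge0.
by rewrite nneseries_sum_bigcup// => k; exact: Po_mass_ge0.
Qed.

HB.instance Definition _ mu := isMeasure.Build _ _ _ (Po mu)
  (Po0 mu) (Po_ge0 mu) (@Po_sigma_additive mu).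

(* Po mu is the product of the Poisson laws of its components. *)
Lemma Po_box (mu : 'rV[R]_d) (A : 'I_d -> set nat) :
  Po mu [set k | forall i, A i (k ord0 i)] =
  \prod_(i < d) poisson_prob (mu ord0 i) 0 (A i).
Proof.
rewrite /Po (esum_rV_prod (f := fun i n => poisson_prob (mu ord0 i) 0 [set n])).
- by apply: eq_bigr => i _; rewrite poisson_prob_esum.
- by move=> i n; exact: measure_ge0.
- by move=> i n; exact: fin_num_measure.
- by move=> i; rewrite -poisson_prob_esum fin_num_measure.
Qed.

Let Po_setT (mu : 'rV[R]_d) : Po mu setT = 1.
Proof.
have -> : [set: 'rV[nat]_d] = [set k | forall i, [set: nat] (k ord0 i)].
  by apply/seteqP; split.
by rewrite (Po_box mu (fun=> setT)) big1// => i _; exact: probability_setT.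
Qed.

HB.instance Definition _ mu := @Measure_isProbability.Build _ _ R (Po mu)
  (Po_setT mu).

End laws.

Section gwi.
Context {dT : measure_display} {T : measurableType dT} {R : realType}.
Variables (P : probability T R) (d : nat).
Implicit Types (xi : nat -> nat -> 'I_d -> {RV P >-> 'rV[nat]_d})
  (eps : nat -> {RV P >-> 'rV[nat]_d}) (X : nat -> T -> 'rV[nat]_d).

Definition gwi_family xi eps (k : nat * nat * 'I_d + nat) :
    {RV P >-> 'rV[nat]_d} :=
  match k with
  | inl (n, j, i) => xi n j i
  | inr n => eps n
  end.

Definition gwi_index : set (nat * nat * 'I_d + nat) :=
  [set k | match k with
           | inl (n, j, _) => (0 < n)%N && (0 < j)%N
           | inr n => (0 < n)%N
           end].

(* Generations n and individuals j are numbered from 1: [xi n j i] and [eps n]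
   are junk for n = 0 or j = 0, and so are [B 0] and [m 0].  Finiteness of the
   means is part of the equations defining [B] and [m]. *)
Record gwi_process xi eps (B : nat -> 'M[R]_d) (m : nat -> 'rV[R]_d) X : Prop :=
  GWIProcess {
  gwi_independent : mutually_independent gwi_index (gwi_family xi eps) ;
  gwi_offspring_id : forall n j i A, (0 < n)%N -> (0 < j)%N ->
    distribution P (xi n j i) A = distribution P (xi n 1%N i) A ;
  gwi_offspring_mean : forall n i l, (0 < n)%N ->
    ('E_P[fun w => (xi n 1%N i w ord0 l)%:R] = (B n i l)%:E)%E ;
  gwi_immigration_mean : forall n l, (0 < n)%N ->
    ('E_P[fun w => (eps n w ord0 l)%:R] = (m n ord0 l)%:E)%E ;
  gwi_init : forall w, X 0%N w = 0 ;
  gwi_step : forall n w, (0 < n)%N ->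
    X n w = \sum_(i < d) \sum_(1 <= j < (X n.-1 w ord0 i).+1) xi n j i w
            + eps n w
}.

Definition bernoulli_offspring xi (B : nat -> 'M[R]_d) : Prop :=
  forall n i A, (0 < n)%N ->
    distribution P (xi n 1%N i) A = Be (row i (B n)) A.

Definition bernoulli_immigration eps (m : nat -> 'rV[R]_d) : Prop :=
  forall n A, (0 < n)%N -> distribution P (eps n) A = Be (m n) A.

(* Weak convergence on R^d: random vectors and laws on Z_+^d are pushed to R^d
   by the coefficientwise cast [natvec]. *)
Definition natvec (k : 'rV[nat]_d) : 'rV[R]_d := map_mx (fun l => l%:R) k.

Definition cvg_in_distribution X (mu : probability 'rV[nat]_d R) : Prop :=
  forall g : 'rV[R]_d -> R, continuous g ->
    (exists M : R, forall x, `|g x| <= M) ->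
    ('E_P[fun w => g (natvec (X n w))] @[n --> \oo]
      --> \int[mu]_k (g (natvec k))%:E)%E.

End gwi.

(* Main.v *)
From HB Require Import structures.
Require Import Defs.
From mathcomp Require Import all_boot all_order all_algebra finmap.
From mathcomp Require Import all_classical all_reals all_analysis.
From mathcomp Require Import measurable_realfun ring lra.

Set Implicit Arguments.
Unset Strict Implicit.
Unset Printing Implicit Defensive.

Import Order.TTheory GRing.Theory Num.Theory.
Import numFieldNormedType.Exports.

Local Open Scope classical_set_scope.
Local Open Scope ring_scope.

(** For Bernoulli laws the generating function of a generation, written at
    [1 - t] instead of [s], is affine in [t]: an individual of type [i] gives
    [1 - (B_n t)_i] and the immigration gives [1 - m_n t].  Composing
    generations therefore only multiplies [t] by mean matrices, and
      [E (1 - t)^X_n = prod_(1 <= j <= n) (1 - m_j B_[j,n] t)]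
    ([pgf_gwi]); in other words X_n has the law of a sum of independent
    Bernoulli vectors.  The theorem is then a law of rare events.

    The mean of X_n is [sum_j m_j B_[j,n]].  Writing
    [m_j = r_j (B - B_j)] for large [j], with [r_j -> lambda], it differs from
    [lambda sum_j (B - B_j) B_[j,n]], which tends to [lambda A], by
    [sum_j (r_j - lambda) (B - B_j) B_[j,n]], up to finitely many terms that
    vanish as [n] grows.  This sum is a Toeplitz transform of a
    null sequence, with weights [(B - B_j) B_[j,n]] that vanish for each fixed
    [j] and have bounded total size, hence it is null ([cvg_mean]).  The factors
    of the product are uniformly close to 1: late ones because [m_j -> 0], early
    ones because [B_[j,n] -> 0].  So the product tends to [exp (- lambda A t)]
    ([cvg_prod_expRN], [cvg_prod_pgf]), which is the generating function of the
    Poisson law ([pgf_Po]).  The Bernoulli laws force the matrices to be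
    substochastic and the vectors [m_j] to be subprobabilities, so that all
    factors lie in [0,1]; the equivalence of norms ([entry_le_opnorm]) turns the
    hypotheses on the operator norm into statements on matrix entries.

    The generating function of X_n is obtained by conditioning on the value of
    the previous generation.  The event [X_(n-1) = k] is independent of all
    later offspring and immigration vectors ([gwi_indep_later]), and on this
    event X_n is a sum of a fixed finite set of these vectors.

    Convergence of the generating functions on ]0,1]^d implies convergence of
    the integrals of all bounded functions on Z_+^d ([pgf_continuity]): the
    functions for which the integrals converge form a uniformly closed vector
    space, point indicators are uniform limits of combinations of powers, and
    the limit is tight. *)

(** * Norms on a finite-dimensional space *)

Lemma entry_le_norm (R : realType) m n (x : 'M[R]_(m, n)) i l : `|x i l| <= `|x|.
Proof.
rewrite [leRHS]/Num.norm /= mx_normrE.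
exact: (@le_bigmax _ _ _ 0 (fun ij => `|x ij.1 ij.2|) (i, l)).
Qed.

Section norm_equivalence.
Context {R : realType} {d : nat} (N : 'rV[R]_d -> R).
Hypothesis normN : is_norm N.

Let N_le_add x y : N (x + y) <= N x + N y. Proof. by case: normN. Qed.
Let N_scale a x : N (a *: x) = `|a| * N x. Proof. by case: normN. Qed.
Let N_eq0 x : N x = 0 -> x = 0. Proof. by case: normN => _ _; exact. Qed.

Let N0 : N 0 = 0. Proof. by rewrite -(scale0r 0) N_scale normr0 mul0r. Qed.

Let N_opp x : N (- x) = N x.
Proof. by rewrite -scaleN1r N_scale normrN1 mul1r. Qed.

Let N_ge0 x : 0 <= N x.
Proof.
by have := N_le_add x (- x); rewrite subrr N0 N_opp -mulr2n pmulrn_lge0.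
Qed.

Let N_sum (I : Type) (r : seq I) (F : I -> 'rV[R]_d) :
  N (\sum_(i <- r) F i) <= \sum_(i <- r) N (F i).
Proof.
elim: r => [|i r IH]; first by rewrite !big_nil N0.
by rewrite !big_cons (le_trans (N_le_add _ _))// lerD2l.
Qed.

Let K := \sum_(i < d) N (delta_mx ord0 i).

Let N_le x : N x <= K * `|x|.
Proof.
rewrite {1}(row_sum_delta x) (le_trans (N_sum _ _))// mulr_suml ler_sum// => i _.
by rewrite N_scale mulrC ler_wpM2l// entry_le_norm.
Qed.

Let N_continuous : continuous N.
Proof.
move=> x; have FF : Filter (nbhs x) by exact: nbhs_filter.
apply/(@cvgrPdist_le _ _ _ (nbhs x)) => e e0.
have K0 : 0 < K + 1 by rewrite ltr_wpDl// sumr_ge0.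
near=> y.
have Nxy : `|N x - N y| <= N (x - y).
  rewrite ler_norml lerBrDr lerBlDr (le_trans _ (N_le_add _ _)) ?subrK// andbT.
  rewrite addrC lerBlDr -[N (x - y)]N_opp opprB.
  by rewrite (le_trans _ (N_le_add _ _))// addrC subrK.
rewrite (le_trans Nxy)// (le_trans (N_le _))//.
rewrite (@le_trans _ _ ((K + 1) * `|x - y|))//.
  by rewrite ler_wpM2r// lerDl.
rewrite -ler_pdivlMl// mulrC.
near: y; have /cvgrPdist_le : (id : 'rV[R]_d -> 'rV[R]_d) y @[y --> x] --> x by [].
by apply; exact: divr_gt0.
Unshelve. all: by end_near. Qed.

(** One half of the equivalence of norms: on the unit sphere of the sup norm,
    which is compact, the continuous function [N] attains a minimum, and this
    minimum is positive since [N] vanishes only at 0. *)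
Lemma coord_le_any_norm :
  exists2 c, 0 < c & forall (x : 'rV[R]_d) i, `|x ord0 i| <= c * N x.
Proof.
pose S := [set x : 'rV[R]_d | `|x| = 1].
(* The sphere is empty only in dimension 0, where every vector is 0. *)
have [S0|/set0P/negP/negbNE/eqP S0] := pselect (S !=set0); last first.
  exists 1 => // x i; have [->|x0] := eqVneq x 0; first by rewrite mxE normr0 mul1r.
  suff : S (`|x|^-1 *: x) by rewrite S0.
  by rewrite /S /= normrZ normfV normr_id mulVf// normr_eq0.
have cS : compact S.
  apply: bounded_closed_compact.
    by exists 1; split=> // M M1 x /= ->; exact: ltW.
  rewrite (_ : S = (fun x : 'rV[R]_d => `|x|) @^-1` [set 1])//.
  apply: closed_comp; last exact: closed_eq.
  by move=> x _; exact: norm_continuous.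
have [x0 + minx0] := compact_EVT_min S0 cS (continuous_subspaceT N_continuous).
rewrite inE => /= x01.
have N0_gt0 : 0 < N x0.
  rewrite lt0r N_ge0 andbT; apply/negP => /eqP /N_eq0 x00.
  by move: x01; rewrite /S /= x00 normr0 => /esym/eqP; rewrite oner_eq0.
exists (N x0)^-1; first by rewrite invr_gt0.
move=> x i; rewrite (le_trans (entry_le_norm _ _ _))//.
have [->|xn0] := eqVneq x 0; first by rewrite normr0 N0 mulr0.
have x_gt0 : 0 < `|x| by rewrite normr_gt0.
rewrite ler_pdivlMl// mulrC -ler_pdivlMl// -[X in X * N x](@ger0_norm _ `|x|^-1)//.
rewrite -N_scale; apply: minx0; rewrite inE /S /= normrZ normfV normr_id mulVf//.
by rewrite gt_eqF.
Qed.

(** The supremum defining [opnorm] is over a bounded set because the coordinates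
    of the unit ball of [N] are bounded ([coord_le_any_norm]). *)
Lemma norm_row_le_opnorm (M : 'M[R]_d) x : N (x *m M) <= N x * opnorm N M.
Proof.
have [c c0 cP] := coord_le_any_norm.
have [->|xn0] := eqVneq x 0; first by rewrite mul0mx N0 mul0r.
have Nx : 0 < N x.
  by rewrite lt0r N_ge0 andbT; apply/eqP => /N_eq0 x0; rewrite x0 eqxx in xn0.
rewrite mulrC -ler_pdivrMr// mulrC.
rewrite -[X in X * N _](@gtr0_norm _ (N x)^-1) ?invr_gt0//.
rewrite -N_scale scalemxAl /opnorm; set E := (X in sup X).
suff hub : has_ubound E.
  have /ubP := ub_le_sup hub; apply; exists ((N x)^-1 *: x) => //=.
  by rewrite N_scale gtr0_norm ?invr_gt0// mulVf ?gt_eqF.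
exists (\sum_(i < d) c * N (row i M)) => _ [y /= y1 <-].
rewrite mulmx_sum_row (le_trans (N_sum _ _))// ler_sum// => i _.
rewrite N_scale ler_wpM2r// (le_trans (cP _ _))// -[leRHS]mulr1.
by rewrite ler_wpM2l// ltW.
Qed.

Lemma entry_le_opnorm : exists2 K : R, 0 <= K &
  forall (M : 'M[R]_d) i l, `|M i l| <= K * opnorm N M.
Proof.
have [c c0 cP] := coord_le_any_norm.
exists (c * \sum_(i < d) N (delta_mx ord0 i)).
  by rewrite mulr_ge0 ?sumr_ge0// ltW.
move=> M i l; have -> : M i l = ((delta_mx ord0 i : 'rV[R]_d) *m M) ord0 l.
  by rewrite -rowE mxE.
rewrite (le_trans (cP _ _))// -mulrA (ler_wpM2l (ltW c0))//.
rewrite (le_trans (norm_row_le_opnorm _ _))// ler_wpM2r//.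
  have Ne : 0 < N (delta_mx ord0 i).
    rewrite lt0r N_ge0 andbT; apply/eqP => /N_eq0 /rowP/(_ i)/eqP.
    by rewrite !mxE !eqxx oner_eq0.
  by rewrite -(pmulr_rge0 _ Ne) (le_trans _ (norm_row_le_opnorm _ _)).
by rewrite (bigD1 i)//= lerDl sumr_ge0.
Qed.

End norm_equivalence.

(** * Triangular arrays *)

Section triangular_arrays.
Context {R : realType}.
Implicit Types t w a : nat -> nat -> R.

Lemma cvg_sum_fixed_range t (b J : nat) :
  (forall j, t j n @[n --> \oo] --> (0 : R)) ->
  \sum_(b <= j < J) t j n @[n --> \oo] --> (0 : R).
Proof.
move=> t0; rewrite [X in _ --> X](_ : _ = \sum_(b <= j < J) (0 : R)).
  by apply: cvg_big => [|j _]; [exact: add_continuous|exact: t0].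
by rewrite big1_eq.
Qed.

(** Toeplitz's lemma: late terms are at most [e] times the total weight [C],
    and early terms, finite in number, vanish one by one. *)
Lemma cvg_toeplitz0 t w (x : nat -> R) (n0 : nat) (C : R) :
  (forall j, t j n @[n --> \oo] --> (0 : R)) ->
  (forall j n, (n0 <= j)%N -> `|t j n| <= x j * w j n) ->
  x @ \oo --> (0 : R) ->
  (forall j n, 0 <= w j n) ->
  (forall n, \sum_(1 <= j < n.+1) w j n <= C) ->
  \sum_(1 <= j < n.+1) t j n @[n --> \oo] --> (0 : R).
Proof.
move=> t0 txw x0 w0 wC.
have C0 : 0 <= C by rewrite (le_trans _ (wC 0%N))// sumr_ge0.
apply/cvgrPdist_le => e e0.
pose e1 := e / 2 / (C + 1).
have C1 : 0 < C + 1 by rewrite ltr_wpDl.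
have e10 : 0 < e1 by rewrite !divr_gt0.
have /cvgrPdist_le/(_ _ e10)[J0 _ J0P] := x0.
pose J := maxn 1 (maxn n0 J0).
have /cvgrPdist_le/(_ _ (divr_gt0 e0 (ltr0n _ 2)))[K0 _ K0P] :=
  cvg_sum_fixed_range 1 J t0.
exists (maxn K0 J) => // n /=; rewrite geq_max => /andP[Kn Jn].
rewrite sub0r normrN (@big_cat_nat _ _ _ J)/= ?leq_maxl//; last exact: leqW.
rewrite (le_trans (ler_normD _ _))// [leRHS]splitr lerD//.
  by have := K0P n Kn; rewrite sub0r normrN.
rewrite (le_trans (ler_norm_sum _ _ _))//.
apply: (@le_trans _ _ (e1 * \sum_(J <= j < n.+1) w j n)).
  rewrite mulr_sumr big_nat_cond [leRHS]big_nat_cond ler_sum// => j.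
  rewrite andbT => /andP[Jj _]; move: Jj; rewrite !geq_max => /and3P[_ nj Jj].
  rewrite (le_trans (txw _ _ nj))// ler_wpM2r// (le_trans (ler_norm _))//.
  by have := J0P j Jj; rewrite sub0r normrN.
have le_wC : \sum_(J <= j < n.+1) w j n <= C.
  rewrite (le_trans _ (wC n))// [leRHS](@big_cat_nat _ _ _ J)/= ?leq_maxl//.
    by rewrite lerDr sumr_ge0.
  exact: leqW.
rewrite (le_trans (ler_wpM2l (ltW e10) le_wC))// /e1 mulrAC ler_pdivrMr//.
by rewrite ler_pM2l ?divr_gt0// lerDl.
Qed.

(** Late terms are small uniformly in [n] because of [x], early ones because
    there are finitely many of them. *)
Lemma uniform_vanishing t (x : nat -> R) (n0 : nat) :
  (forall j, t j n @[n --> \oo] --> (0 : R)) ->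
  (forall j n, (n0 <= j)%N -> (j <= n)%N -> `|t j n| <= x j) ->
  x @ \oo --> (0 : R) ->
  forall e, 0 < e -> \forall n \near \oo,
    forall j, (j <= n)%N -> `|t j n| <= e.
Proof.
move=> t0 tx x0 e e0.
have /cvgrPdist_le/(_ _ e0)[J0 _ J0P] := x0.
pose J := maxn n0 J0.
have tn0 j : `|t j n| @[n --> \oo] --> (0 : R).
  by rewrite -(@normr0 _ R); exact: cvg_norm.
have /cvgrPdist_le/(_ _ e0)[K0 _ K0P] := cvg_sum_fixed_range 0 J tn0.
exists K0 => // n /= Kn j jn; have [jJ|Jj] := ltnP j J.
  have := K0P n Kn; rewrite sub0r normrN ger0_norm ?sumr_ge0//; apply: le_trans.
  rewrite big_mkord (bigD1 (Ordinal jJ))//= lerDl sumr_ge0//.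
move: (Jj); rewrite geq_max => /andP[nj Jj'].
rewrite (le_trans (tx _ _ nj jn))// (le_trans (ler_norm _))//.
by have := J0P j Jj'; rewrite sub0r normrN.
Qed.

(** Apply [1 + y <= expR y] to [y := x / (1 - x)], for which
    [1 + y = (1 - x)^-1]. *)
Lemma expRN_le_1Bx (x : R) : x < 1 -> expR (- (x / (1 - x))) <= 1 - x.
Proof.
move=> x1; have x1_gt0 : 0 < 1 - x by rewrite subr_gt0.
rewrite expRN -[leRHS]invrK lef_pV2 ?posrE ?invr_gt0 ?expR_gt0//.
suff {1}-> : (1 - x)^-1 = 1 + x / (1 - x) by exact: expR_ge1Dx.
by field; rewrite gt_eqF.
Qed.

(** Law of rare events.  If all [a j n] are at most [e <= 1 / 2] then
    [x / (1 - x) <= (1 + 2 * e) * x] for [x := a j n], so with [S] the sum the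
    product lies between [expR (- (1 + 2 * e) * S)] and [expR (- S)]; these
    differ by at most [2 * e * S]. *)
Lemma cvg_prod_expRN a (l : R) :
  (forall j n, (0 < j)%N -> 0 <= a j n) ->
  (forall e, 0 < e -> \forall n \near \oo, forall j, (j <= n)%N -> a j n <= e) ->
  \sum_(1 <= j < n.+1) a j n @[n --> \oo] --> l ->
  \prod_(1 <= j < n.+1) (1 - a j n) @[n --> \oo] --> expR (- l).
Proof.
move=> a0 a_unif a_sum.
pose S n := \sum_(1 <= j < n.+1) a j n.
pose P n := \prod_(1 <= j < n.+1) (1 - a j n).
have S0 n : 0 <= S n.
  rewrite /S big_nat_cond sumr_ge0// => j.
  by rewrite andbT => /andP[j0 _]; exact: a0.
suff d0 : (expR (- S n) - P n) @[n --> \oo] --> (0 : R).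
  rewrite (_ : (fun n => P n) =
      (fun n => expR (- S n) - (expR (- S n) - P n))); last first.
    by apply/funext => n; rewrite opprB addrC subrK.
  rewrite -[expR (- l)]subr0; apply: cvgB => //.
  apply: continuous_cvg; first exact: continuous_expR.
  exact: cvgN.
have l0 : 0 <= l.
  rewrite -(cvg_lim (@Rhausdorff R) a_sum); apply: limr_ge; last exact: nearW.
  by apply/cvg_ex; exists l.
apply/cvgrPdist_le => e e0.
pose e1 := Num.min (2^-1) (e / (2 * (l + 1))).
have l1 : 0 < l + 1 by rewrite ltr_wpDl.
have e10 : 0 < e1 by rewrite lt_min invr_gt0 ltr0n divr_gt0// mulr_gt0.
near=> n.
have Sn : S n <= l + 1.
  rewrite -lerBlDl (le_trans (ler_norm _))// distrC.
  by near: n; move/cvgrPdist_le : a_sum; apply.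
have an j : (j <= n)%N -> a j n <= e1 by move: j; near: n; exact: a_unif.
have a2 j : (j <= n)%N -> a j n <= 2^-1.
  by move=> /an /le_trans; apply; rewrite ge_min lexx.
have a1 j : (j <= n)%N -> a j n < 1.
  by move=> /a2 /le_lt_trans; apply; rewrite invf_lt1// ltr1n.
rewrite sub0r normrN ger0_norm; last first.
  rewrite subr_ge0 /S -sumrN expR_sum /P.
  rewrite big_nat_cond [leRHS]big_nat_cond; apply: ler_prod => j.
  rewrite andbT ltnS => /andP[_ jn]; rewrite subr_ge0 ltW ?a1//=.
  exact: expR_ge1Dx.
have Plow : expR (- ((1 + 2 * e1) * S n)) <= P n.
  rewrite /S mulr_sumr -sumrN expR_sum /P.
  rewrite big_nat_cond [leRHS]big_nat_cond; apply: ler_prod => j.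
  rewrite andbT ltnS => /andP[j_gt0 jn]; rewrite expR_ge0/=.
  rewrite (le_trans _ (expRN_le_1Bx (a1 _ jn)))// ler_expR lerN2.
  have := a1 _ jn; have := a2 _ jn; have := an _ jn; have := a0 j n j_gt0.
  move: (a j n) => x x0 xe x2 x1.
  rewrite ler_pdivrMr ?subr_gt0//.
  rewrite mulrAC mulrC -[leLHS]mulr1 ler_wpM2l//.
  have : x <= 2 * e1 * (1 - x); last by lra.
  have : e1 <= 2 * e1 * (1 - x); last by lra.
  by rewrite mulrAC mulrC -[leLHS]mulr1 ler_wpM2l ?(ltW e10)//; lra.
rewrite (le_trans (lerB (lexx _) Plow))// mulrDl mul1r opprD expRD.
rewrite -{1}[expR (- S n)]mulr1 -mulrBr.
apply: (@le_trans _ _ (1 * (2 * e1 * S n))).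
  rewrite ler_pM ?expR_ge0 ?subr_ge0//.
  - by rewrite -expR0 ler_expR oppr_le0 !mulr_ge0// ltW.
  - by rewrite -expR0 ler_expR oppr_le0.
  - by rewrite lerBlDr -lerBlDl expR_ge1Dx.
rewrite mul1r (@le_trans _ _ (2 * (e / (2 * (l + 1))) * (l + 1)))//.
  by rewrite ler_pM ?mulr_ge0// ?(ltW e10)// ler_wpM2l// ge_min lexx orbT.
have -> : 2 * (e / (2 * (l + 1))) * (l + 1) = e by field; rewrite gt_eqF.
exact: lexx.
Unshelve. all: by end_near. Qed.

End triangular_arrays.

(** * Products of mean matrices *)

Section mean_matrices.
Context {R : realType} {d : nat}.
Implicit Types (B : nat -> 'M[R]_d) (m : nat -> 'rV[R]_d) (p : 'rV[R]_d).

(** Makes the generic lemmas on big operators apply to [mxprod]. *)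
HB.instance Definition _ := Monoid.isLaw.Build 'M[R]_d 1%:M mulmx
  (@mulmxA R d d d d) (@mul1mx R d d) (@mulmx1 R d d).

Definition subprobability p :=
  (forall i, 0 <= p ord0 i) /\ \sum_(i < d) p ord0 i <= 1.

Lemma cvg_entry k q (F : nat -> 'M[R]_(k, q)) (L : 'M[R]_(k, q)) i l :
  F @ \oo --> L -> F n i l @[n --> \oo] --> L i l.
Proof.
move=> FL; apply: (cvg_comp F (fun M : 'M[R]_(k, q) => M i l) FL).
exact: coord_continuous.
Qed.

Lemma mxprod_recr B j n : (j <= n)%N -> mxprod B j n.+1 = mxprod B j n *m B n.+1.
Proof. by move=> jn; rewrite /mxprod big_nat_recr. Qed.

Lemma mxprodnn B n : mxprod B n n = 1%:M.
Proof. by rewrite /mxprod big_geq. Qed.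

Lemma cvg_mulmx_entry (F : nat -> 'M[R]_d) (L : 'M[R]_d) p l :
  (forall i l, F n i l @[n --> \oo] --> L i l) ->
  (p *m F n) ord0 l @[n --> \oo] --> (p *m L) ord0 l.
Proof.
move=> FL; rewrite mxE; under eq_fun do rewrite mxE.
apply: cvg_big => [|i _]; first exact: add_continuous.
by apply: cvgM; [exact: cvg_cst|exact: FL].
Qed.

Definition entries_sum (M : 'M[R]_d) := \sum_i \sum_l `|M i l|.

Lemma entries_sum_ge0 M : 0 <= entries_sum M.
Proof. by rewrite sumr_ge0// => i _; rewrite sumr_ge0. Qed.

Lemma ler_mulmx_entries_sum p M l :
  `|(p *m M) ord0 l| <= (\sum_i `|p ord0 i|) * entries_sum M.
Proof.
rewrite mxE (le_trans (ler_norm_sum _ _ _))// mulr_suml ler_sum// => i _.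
rewrite normrM ler_wpM2l// /entries_sum (bigD1 i)//= (bigD1 l)//= -addrA lerDl.
by rewrite addr_ge0 ?sumr_ge0// => k _; rewrite sumr_ge0.
Qed.

Lemma substochastic_mulmx (M : 'M[R]_d) (t : 'cV[R]_d) :
  (forall i, subprobability (row i M)) ->
  (forall i, 0 <= t i ord0 <= 1) -> forall i, 0 <= (M *m t) i ord0 <= 1.
Proof.
move=> MP tP i; rewrite mxE; have [M0 M1] := MP i.
have Mi l : 0 <= M i l by have := M0 l; rewrite mxE.
rewrite sumr_ge0/=; last by move=> l _; rewrite mulr_ge0//; have /andP[] := tP l.
rewrite (le_trans _ M1)// ler_sum// => l _; rewrite mxE -[leRHS]mulr1.
by rewrite ler_wpM2l//; have /andP[] := tP l.
Qed.

Lemma mxprod_box B j n (t : 'cV[R]_d) :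
  (forall n i, (0 < n)%N -> subprobability (row i (B n))) ->
  (forall i, 0 <= t i ord0 <= 1) -> forall i, 0 <= (mxprod B j n *m t) i ord0 <= 1.
Proof.
move=> BP tP; rewrite /mxprod big_nat_cond.
elim/big_ind : _ t tP => [t tP|M1 M2 IH1 IH2 t tP|k].
- by rewrite mul1mx.
- by rewrite -mulmxA; apply: IH1; exact: IH2.
- rewrite andbT => /andP[k0 _] t tP; apply: substochastic_mulmx => // i.
  by apply: BP; exact: leq_ltn_trans k0.
Qed.

Lemma mul_subprobability_box p (t : 'cV[R]_d) :
  subprobability p -> (forall i, 0 <= t i ord0 <= 1) ->
  0 <= (p *m t) ord0 ord0 <= \sum_i p ord0 i.
Proof.
move=> [p0 p1] tP; rewrite mxE sumr_ge0/=; last first.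
  by move=> i _; rewrite mulr_ge0//; have /andP[] := tP i.
rewrite ler_sum// => i _; rewrite -[leRHS]mulr1 ler_wpM2l//.
by have /andP[] := tP i.
Qed.

Section limit_of_means.
Variables (B : nat -> 'M[R]_d) (m : nat -> 'rV[R]_d) (N : 'rV[R]_d -> R)
  (Blim A : 'M[R]_d) (lambda : 'rV[R]_d) (n0 : nat) (C : R).
Hypotheses (normN : is_norm N)
  (B_subprob : forall n i, (0 < n)%N -> subprobability (row i (B n)))
  (m_subprob : forall n, (0 < n)%N -> subprobability (m n))
  (B_cvg : B n @[n --> \oo] --> Blim)
  (unitB : forall n, (n0 <= n)%N -> Blim - B n \in unitmx)
  (mxprod_cvg : forall j : nat, opnorm N (mxprod B j n) @[n --> \oo] --> (0 : R))
  (A_cvg : (\sum_(1 <= j < n.+1) (Blim - B j) *m mxprod B j n) @[n --> \oo] --> A)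
  (bounded : forall n,
     \sum_(1 <= j < n.+1) opnorm N ((Blim - B j) *m mxprod B j n) <= C)
  (lambda_cvg : (m n *m invmx (Blim - B n)) @[n --> \oo] --> lambda).

Let r n := m n *m invmx (Blim - B n).
Let D j n := (Blim - B j) *m mxprod B j n.

Let mE n : (n0 <= n)%N -> m n = r n *m (Blim - B n).
Proof. by move=> nn; rewrite /r mulmxKV// unitB. Qed.

Lemma mxprod_entry_cvg0 j i l : mxprod B j n i l @[n --> \oo] --> (0 : R).
Proof.
have [K K0 KP] := entry_le_opnorm normN.
apply/norm_cvg0P.
apply: (@squeeze_cvgr _ _ _ _ (cst 0) (fun n => K * opnorm N (mxprod B j n))).
- by near=> n; rewrite normr_ge0/= KP.
- exact: cvg_cst.
- by rewrite -[X in _ --> X](mulr0 K); apply: cvgM => //; exact: cvg_cst.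
Unshelve. all: by end_near. Qed.

Lemma mul_mxprod_cvg0 p j l : (p *m mxprod B j n) ord0 l @[n --> \oo] --> (0 : R).
Proof.
rewrite [X in _ --> X](_ : _ = (p *m 0) ord0 l); last by rewrite mulmx0 mxE.
apply: cvg_mulmx_entry => i k; rewrite mxE; exact: mxprod_entry_cvg0.
Qed.

(** Eventually [m n = r n *m (Blim - B n)], where [r n] converges and
    [Blim - B n] tends to 0. *)
Lemma immigration_mean_cvg0 i : m n ord0 i @[n --> \oo] --> (0 : R).
Proof.
have cvgrB : (r n *m (Blim - B n)) ord0 i @[n --> \oo]
    --> (lambda *m (Blim - Blim)) ord0 i.
  rewrite mxE; under eq_fun do rewrite mxE.
  apply: cvg_big => [|k _]; first exact: add_continuous.
  apply: cvgM; first exact: cvg_entry.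
  rewrite !mxE; under eq_fun do rewrite !mxE.
  by apply: cvgB; [exact: cvg_cst|exact: cvg_entry].
move: cvgrB; rewrite subrr mulmx0 mxE; apply: cvg_trans.
apply: near_eq_cvg; exists n0 => // n /= nn.
by rewrite -mE.
Qed.

Let v j := m j - lambda *m (Blim - B j).

(** With [r j := m j *m invmx (Blim - B j)], the terms of the sum differ from
    those of the sum tending to [A], multiplied by [lambda], by
    [(r j - lambda) *m D j n] for [j >= n0].  The entries of [D j n] serve as the
    weights of [cvg_toeplitz0], applied to the null sequence [r j - lambda]. *)
Lemma cvg_mean l :
  (\sum_(1 <= j < n.+1) m j *m mxprod B j n) ord0 l @[n --> \oo]
    --> (lambda *m A) ord0 l.
Proof.
have [K K0 KP] := entry_le_opnorm normN.
pose x j := \sum_i `|(r j - lambda) ord0 i|.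
have v0 : \sum_(1 <= j < n.+1) (v j *m mxprod B j n) ord0 l @[n --> \oo] --> (0 : R).
  apply: (@cvg_toeplitz0 _ _ (fun j n => entries_sum (D j n)) x n0
    (\sum_(i < d) \sum_(l < d) K * C)).
  - by move=> j; exact: mul_mxprod_cvg0.
  - move=> j n nj; rewrite /v {1}mE// -mulmxBl -mulmxA.
    exact: ler_mulmx_entries_sum.
  - rewrite [X in _ --> X](_ : _ = \sum_(i < d) (0 : R)); last by rewrite big1_eq.
    apply: cvg_big => [|i _]; first exact: add_continuous.
    rewrite -(@normr0 _ R); apply: cvg_norm.
    have := @cvg_entry _ _ _ _ ord0 i lambda_cvg.
    move=> /cvgrPdist_le rl; apply/cvgrPdist_le => e e0.
    have [J _ JP] := rl e e0; exists J => // n /JP.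
    by rewrite sub0r normrN -normrN opprB !mxE distrC.
  - by move=> j n; exact: entries_sum_ge0.
  - move=> n; rewrite exchange_big/= ler_sum// => i _.
    rewrite exchange_big/= ler_sum// => k _.
    apply: le_trans (ler_wpM2l K0 (bounded n)).
    by rewrite mulr_sumr ler_sum// => j _; exact: KP.
have lambdaA : (lambda *m \sum_(1 <= j < n.+1) D j n) ord0 l @[n --> \oo]
    --> (lambda *m A) ord0 l.
  apply: (@cvg_mulmx_entry (fun n => \sum_(1 <= j < n.+1) D j n)) => i k.
  exact: cvg_entry A_cvg.
rewrite -[X in _ --> X]add0r.
rewrite [X in X @ _ --> _](_ : _ = (fun n =>
  \sum_(1 <= j < n.+1) (v j *m mxprod B j n) ord0 l
  + (lambda *m \sum_(1 <= j < n.+1) D j n) ord0 l)); first exact: cvgD.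
apply/funext => n; rewrite mulmx_sumr !summxE -big_split/=.
apply: eq_bigr => j _; rewrite /v mulmxBl -mulmxA.
by rewrite [X in _ = X + _]mxE [X in _ + X + _]mxE subrK.
Qed.

(** A limit of nonnegative numbers: the [l]-th coordinate of [m j *m mxprod B j n]
    is its product with the column [e_l], to which [mxprod_box] applies. *)
Lemma limit_mean_ge0 l : 0 <= (lambda *m A) ord0 l.
Proof.
rewrite -(cvg_lim (@Rhausdorff R) (@cvg_mean l)).
apply: limr_ge.
  by apply/cvg_ex; exists ((lambda *m A) ord0 l); exact: cvg_mean.
apply: nearW => n; rewrite summxE big_nat_cond sumr_ge0// => j.
rewrite andbT => /andP[j0 _].
have tP i : 0 <= (delta_mx l ord0 : 'cV[R]_d) i ord0 <= 1.
  by rewrite mxE ler0n lern1 leq_b1.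
have /andP[+ _] :=
  mul_subprobability_box (m_subprob j0) (mxprod_box j n B_subprob tP).
by rewrite mulmxA -colE mxE.
Qed.

(** The factors are uniformly close to 1: for large [j] because [m j] is small and
    [mxprod B j n *m t] stays in the unit cube, for each fixed [j] because
    [mxprod B j n] tends to 0. *)
Lemma cvg_prod_pgf (t : 'cV[R]_d) : (forall i, 0 <= t i ord0 <= 1) ->
  \prod_(1 <= j < n.+1) (1 - (m j *m mxprod B j n *m t) ord0 ord0) @[n --> \oo]
    --> expR (- (lambda *m A *m t) ord0 ord0).
Proof.
move=> tP; pose a j n := (m j *m mxprod B j n *m t) ord0 ord0.
apply: (@cvg_prod_expRN _ a).
- move=> j n j0; rewrite /a -mulmxA.
  by have /andP[] :=
    mul_subprobability_box (m_subprob j0) (mxprod_box j n B_subprob tP).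
- move=> e e0.
  suff : \forall n \near \oo, forall j, (j <= n)%N -> `|a j n| <= e.
    apply: filterS => n anP j jn; exact: le_trans (ler_norm _) (anP j jn).
  apply: (@uniform_vanishing _ _ (fun j => \sum_i m j ord0 i) 1) e0.
  + move=> j; rewrite /a; under eq_fun do rewrite mxE.
    suff : \sum_i (m j *m mxprod B j n) ord0 i * t i ord0 @[n --> \oo]
        --> \sum_(i < d) (0 * t i ord0).
      by rewrite [X in _ --> X]big1// => i _; rewrite mul0r.
    apply: cvg_big => [|i _]; first exact: add_continuous.
    by apply: cvgM; [exact: mul_mxprod_cvg0|exact: cvg_cst].
  + move=> j n j0 _; rewrite /a -mulmxA.
    have /andP[? ?] :=
      mul_subprobability_box (m_subprob j0) (mxprod_box j n B_subprob tP).
    by rewrite ger0_norm.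
  + rewrite [X in _ --> X](_ : _ = \sum_(i < d) (0 : R)); last by rewrite big1_eq.
    apply: cvg_big => [|i _]; [exact: add_continuous|exact: immigration_mean_cvg0].
- have : (\sum_(1 <= j < n.+1) m j *m mxprod B j n *m t) ord0 ord0 @[n --> \oo]
    --> (lambda *m A *m t) ord0 ord0.
    rewrite mxE; under eq_fun do rewrite -mulmx_suml mxE.
    apply: cvg_big => [|i _]; first exact: add_continuous.
    by apply: cvgM; [exact: cvg_mean|exact: cvg_cst].
  by under eq_fun do rewrite summxE.
Qed.

End limit_of_means.
End mean_matrices.

(** * Bounded functions on Z_+^d *)

Section bounded_functions.
Context {R : realType} {d : nat}.
Notation vec := 'rV[nat]_d.
Implicit Types (f g h : vec -> R) (mu nu : probability vec R).

Definition bounded_fun f := exists M, forall k, `|f k| <= M.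

Lemma bounded_integrable mu f : bounded_fun f -> mu.-integrable setT (EFin \o f).
Proof.
move=> [M fM]; apply: measurable_bounded_integrable => //.
- exact: (le_lt_trans (probability_le1 mu measurableT) (ltry 1)).
- exists M; split=> [|M' MM' k _]; first exact: num_real.
  exact: le_trans (fM k) (ltW MM').
Qed.

Lemma bounded_funD f g : bounded_fun f -> bounded_fun g ->
  bounded_fun (fun k => f k + g k).
Proof.
move=> [M fM] [M' gM']; exists (M + M') => k.
by rewrite (le_trans (ler_normD _ _))// lerD.
Qed.

Lemma bounded_funM f g : bounded_fun f -> bounded_fun g ->
  bounded_fun (fun k => f k * g k).
Proof.
by move=> [M fM] [M' gM']; exists (M * M') => k; rewrite normrM ler_pM.
Qed.

Lemma bounded_fun_cst (c : R) : bounded_fun (fun=> c).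
Proof. by exists `|c|. Qed.

Lemma bounded_fun_sum (I : Type) (r : seq I) (F : I -> vec -> R) :
  (forall i, bounded_fun (F i)) -> bounded_fun (fun k => \sum_(i <- r) F i k).
Proof.
move=> bF; elim: r => [|i r IH].
  by under eq_fun do rewrite big_nil; exact: bounded_fun_cst.
by under eq_fun do rewrite big_cons; exact: bounded_funD.
Qed.

Lemma bounded_RintegralD mu f g : bounded_fun f -> bounded_fun g ->
  (\int[mu]_k (f k + g k) = \int[mu]_k f k + \int[mu]_k g k)%R.
Proof. by move=> bf bg; rewrite RintegralD//; exact: bounded_integrable. Qed.

Lemma bounded_RintegralZl mu c f : bounded_fun f ->
  (\int[mu]_k (c * f k) = c * \int[mu]_k f k)%R.
Proof. by move=> bf; rewrite RintegralZl//; exact: bounded_integrable. Qed.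

Lemma Rintegral_prob_cst mu (c : R) : (\int[mu]_k c = c)%R.
Proof.
rewrite Rintegral_cst// -[RHS]mulr1; congr (_ * _).
exact: (congr1 fine (probability_setT mu)).
Qed.

Lemma le_norm_Rintegral mu f g : bounded_fun f -> bounded_fun g ->
  (forall k, `|f k| <= g k) -> `|\int[mu]_k f k|%R <= (\int[mu]_k g k)%R.
Proof.
move=> bf bg fg; rewrite (le_trans (le_normr_Rintegral _ _))//.
  exact: bounded_integrable.
apply: le_Rintegral => //; last exact: bounded_integrable.
by apply: integrable_norm; exact: bounded_integrable.
Qed.

Lemma EFin_Rintegral nu f : bounded_fun f ->
  (\int[nu]_k (f k)%:E)%E = ((\int[nu]_k f k)%R)%:E.
Proof.
move=> bf; rewrite /Rintegral fineK//; apply: integrable_fin_num => //.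
exact: bounded_integrable.
Qed.

Lemma Rintegral_indicator nu (A : set vec) : (\int[nu]_k \1_A k)%R = fine (nu A).
Proof. by rewrite /Rintegral integral_indic// setIT. Qed.

Lemma bounded_fun_indic (A : set vec) : bounded_fun (fun k : vec => \1_A k : R).
Proof.
by exists 1 => k; rewrite indicE; case: (_ \in _); rewrite ?normr1 ?normr0.
Qed.

Lemma bounded_Rintegral_sum nu (I : Type) (r : seq I) (F : I -> vec -> R) :
  (forall i, bounded_fun (F i)) ->
  (\int[nu]_k (\sum_(i <- r) F i k))%R = \sum_(i <- r) (\int[nu]_k F i k)%R.
Proof.
move=> bF; elim: r => [|i r IH].
  by under eq_Rintegral do rewrite big_nil; rewrite Rintegral_prob_cst big_nil.
under eq_Rintegral do rewrite big_cons.
by rewrite bounded_RintegralD ?IH ?big_cons//; exact: bounded_fun_sum.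
Qed.

Definition monomial (s : 'I_d -> R) (k : vec) : R := \prod_i s i ^+ k ord0 i.

Lemma monomialD s k k' : monomial s (k + k') = monomial s k * monomial s k'.
Proof.
by rewrite /monomial -big_split; apply: eq_bigr => i _; rewrite mxE exprD.
Qed.

Lemma monomial0 s : monomial s 0 = 1.
Proof. by rewrite /monomial big1// => i _; rewrite mxE. Qed.

Lemma monomial_ge0 s k : (forall i, 0 <= s i) -> 0 <= monomial s k.
Proof. by move=> s0; apply: prodr_ge0 => i _; rewrite exprn_ge0. Qed.

Lemma monomial_le1 s k : (forall i, 0 <= s i <= 1) -> `|monomial s k| <= 1.
Proof.
move=> sP; rewrite normr_prod; apply: prodr_ile1 => i _; have /andP[s0 s1] := sP i.
by rewrite normr_ge0 normrX ger0_norm//= exprn_ile1.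
Qed.

Lemma bounded_monomial s : (forall i, 0 <= s i <= 1) -> bounded_fun (monomial s).
Proof. by move=> sP; exists 1 => k; exact: monomial_le1. Qed.

End bounded_functions.

(** * Continuity theorem for probability generating functions *)

Section pgf_continuity.
Context {R : realType} {d : nat}.
Notation vec := 'rV[nat]_d.
Implicit Types (f g : vec -> R) (nu : probability vec R).
Variables (mu_ : nat -> probability vec R) (mu : probability vec R).

Definition test_fun f := bounded_fun f /\
  (\int[mu_ n]_k f k)%R @[n --> \oo] --> (\int[mu]_k f k)%R.

Lemma test_funD f g : test_fun f -> test_fun g -> test_fun (fun k => f k + g k).
Proof.
move=> [bf cf] [bg cg]; split; first exact: bounded_funD.
under eq_fun do rewrite bounded_RintegralD//; rewrite bounded_RintegralD//.
exact: cvgD.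
Qed.

Lemma test_funZ c f : test_fun f -> test_fun (fun k => c * f k).
Proof.
move=> [bf cf]; split; first by apply: bounded_funM => //; exact: bounded_fun_cst.
under eq_fun do rewrite bounded_RintegralZl//; rewrite bounded_RintegralZl//.
by apply: cvgM => //; exact: cvg_cst.
Qed.

Lemma test_fun_sum (I : Type) (r : seq I) (F : I -> vec -> R) :
  (forall i, test_fun (F i)) -> test_fun (fun k => \sum_(i <- r) F i k).
Proof.
move=> tF; elim: r => [|i r IH].
  under eq_fun do rewrite big_nil; split; first exact: bounded_fun_cst.
  under eq_fun do rewrite Rintegral_prob_cst; rewrite Rintegral_prob_cst.
  exact: cvg_cst.
by under eq_fun do rewrite big_cons; exact: test_funD.
Qed.

Lemma test_fun_uniform_limit f :
  (forall e, 0 < e -> exists2 g, test_fun g & forall k, `|f k - g k| <= e) ->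
  test_fun f.
Proof.
move=> fapp.
have bf : bounded_fun f.
  have [g [[M gM] _] fg] := fapp 1 ltr01; exists (1 + M) => k.
  by rewrite -[f k](subrK (g k)) (le_trans (ler_normD _ _))// lerD.
split => //; apply/cvgrPdist_le => e e0.
have e3 : 0 < e / 3 by rewrite divr_gt0.
have [g [bg cg] fg] := fapp _ e3.
have close nu : `|(\int[nu]_k f k)%R - (\int[nu]_k g k)%R| <= e / 3.
  have bNg : bounded_fun (fun k => -1 * g k).
    by apply: bounded_funM => //; exact: bounded_fun_cst.
  rewrite -[X in _ - X]mul1r -mulNr -bounded_RintegralZl// -bounded_RintegralD//.
  rewrite -[leRHS](Rintegral_prob_cst nu); apply: le_norm_Rintegral.
  - exact: bounded_funD.
  - exact: bounded_fun_cst.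
  - by move=> k; rewrite mulN1r.
near=> n.
have gn : `|(\int[mu]_k g k)%R - (\int[mu_ n]_k g k)%R| <= e / 3.
  by near: n; move/cvgrPdist_le : cg; exact.
have := close mu; have := close (mu_ n); move: gn; rewrite !ler_norml.
move=> /andP[? ?] /andP[? ?] /andP[? ?]; apply/andP; split; lra.
Unshelve. all: by end_near. Qed.

Lemma eq_test_fun f g : f =1 g -> test_fun f -> test_fun g.
Proof. by move=> /funext ->. Qed.

(** The indicator of [m] is recovered from powers: for small [s],
    [(s ^+ n - \sum_(j < m) s ^+ j * (n == j)) / s ^+ m] vanishes for [n < m],
    equals 1 for [n = m], and is at most [s] for [n > m]. *)
Lemma test_fun_indicator (i : 'I_d) g :
  (forall k, `|g k| <= 1) ->
  (forall s, 0 < s <= 1 -> test_fun (fun k => s ^+ k ord0 i * g k)) ->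
  forall m : nat, test_fun (fun k => (k ord0 i == m)%:R * g k).
Proof.
move=> g1 tg; elim/ltn_ind => m IH.
apply: test_fun_uniform_limit => e e0.
(* The error of the approximation below is at most [s]. *)
pose s := Num.min 1 e.
have s0 : 0 < s by rewrite lt_min ltr01.
have s1 : s <= 1 by rewrite ge_min lexx.
pose F (k : vec) := s ^- m * (s ^+ k ord0 i * g k
  + \sum_(j < m) (- s ^+ j) * ((k ord0 i == j)%:R * g k)).
exists F.
  apply: test_funZ; apply: test_funD; first by apply: tg; rewrite s0.
  by apply: test_fun_sum => j; apply: test_funZ; exact: IH.
move=> k; rewrite /F; move: (k ord0 i) => n.
under eq_bigr do rewrite mulrA; rewrite -mulr_suml -mulrDl mulrA -mulrBl normrM.
rewrite -[leRHS]mulr1 ler_pM//.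
have sm : s ^+ m != 0 by rewrite expf_neq0 ?gt_eqF.
case: (ltngtP n m) => [nm|mn|->].
- rewrite (bigD1 (Ordinal nm))//= eqxx mulr1 big1; last first.
    move=> j /eqP jn; case: eqP => [nj|]; rewrite ?mulr0//.
    by case: jn; exact/val_inj.
  by rewrite addr0 subrr mulr0 subr0 normr0 ltW.
- rewrite big1 ?addr0; last first.
    by move=> j _; rewrite gtn_eqF ?mulr0// (ltn_trans _ mn).
  rewrite sub0r normrN -(subnK (ltnW mn)) exprD mulrCA mulVf// mulr1.
  rewrite ger0_norm; last by rewrite exprn_ge0// ltW.
  rewrite (@le_trans _ _ s)//; last by rewrite ge_min lexx orbT.
  by rewrite -[leRHS]expr1 ler_wiXn2l ?subn_gt0// ltW.
- rewrite big1 ?addr0; last by move=> j _; rewrite gtn_eqF ?mulr0.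
  by rewrite mulVf// subrr normr0 ltW.
Qed.

Hypothesis pgf_cvg : forall s : 'I_d -> R, (forall i, 0 < s i <= 1) ->
  (\int[mu_ n]_k monomial s k)%R @[n --> \oo]
    --> (\int[mu]_k monomial s k)%R.

(* The powers of the coordinates in [l] are kept next to their indicators: they
   are what [test_fun_indicator] turns into an indicator at the next step, and
   [s := 1] removes them in the end. *)
Let test_fun_mixed (l : seq 'I_d) (m : 'I_d -> nat) (s : 'I_d -> R) :
  (forall i, 0 < s i <= 1) ->
  test_fun (fun k => \prod_(i <- l) (k ord0 i == m i)%:R * monomial s k).
Proof.
elim: l s => [|i l IH] s sP.
  have sP' i : 0 <= s i <= 1 by have /andP[/ltW -> ->] := sP i.
  under eq_fun do rewrite big_nil mul1r; split; last exact: pgf_cvg.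
  exact: bounded_monomial.
apply: (@eq_test_fun (fun k => (k ord0 i == m i)%:R *
    (\prod_(j <- l) (k ord0 j == m j)%:R * monomial s k))).
  by move=> k; rewrite big_cons mulrA.
apply: test_fun_indicator => [k|u /andP[u0 u1]].
  rewrite normrM mulr_ile1//; last first.
    by apply: monomial_le1 => j; have /andP[/ltW -> ->] := sP j.
  rewrite normr_prod; apply: prodr_ile1 => j _; rewrite normr_ge0/=.
  by case: eqP; rewrite ?normr1 ?normr0.
pose s' j := if j == i then u * s i else s j.
apply: (@eq_test_fun (fun k => \prod_(j <- l) (k ord0 j == m j)%:R *
    monomial s' k)); last first.
  apply: IH => j; rewrite /s'; case: ifP => // _; have /andP[si0 si1] := sP i.
  by rewrite mulr_gt0//= mulr_ile1// ltW.
move=> k; rewrite mulrCA; congr (_ * _).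
rewrite /monomial (bigD1 i)//= [in RHS](bigD1 i)//= /s' eqxx exprMn mulrA.
congr (_ * _).
by apply: eq_bigr => j /negbTE ->.
Qed.

Lemma test_fun_point (v : vec) : test_fun (fun k => (k == v)%:R).
Proof.
apply: (@eq_test_fun (fun k =>
    \prod_(i <- index_enum 'I_d) (k ord0 i == v ord0 i)%:R
      * monomial (fun=> 1) k)); last first.
  apply: (@test_fun_mixed _ (fun i => v ord0 i) (fun=> 1)) => i.
  by rewrite ltr01 lexx.
move=> k; rewrite [monomial _ _]big1 ?mulr1; last by move=> i _; rewrite expr1n.
have [->|kv] := eqVneq k v; first by rewrite big1// => i _; rewrite eqxx.
have /existsP[i kvi] : [exists i, k ord0 i != v ord0 i].
  apply/existsPn => kvi; move/eqP : kv; apply; apply/rowP => i.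
  by apply/eqP; have := kvi i; rewrite negbK.
by rewrite (bigD1 i)//= (negbTE kvi) mul0r.
Qed.

Definition box (b : nat) (k : vec) := [forall i, (k ord0 i < b)%N].

Lemma test_fun_box b f : test_fun (fun k => (box b k)%:R * f k).
Proof.
pose V (v : {ffun 'I_d -> 'I_b}) : vec := \row_i (v i : nat).
apply: (@eq_test_fun (fun k =>
    \sum_(v : {ffun 'I_d -> 'I_b}) f (V v) * (k == V v)%:R)).
  move=> k; have [kb|kb] := boolP (box b k).
    have kb' i : (k ord0 i < b)%N by exact: (forallP kb i).
    pose v : {ffun 'I_d -> 'I_b} := [ffun i => Ordinal (kb' i)].
    have kv : k = V v by apply/rowP => i; rewrite mxE ffunE.
    rewrite (bigD1 v)//= -kv eqxx mulr1 mul1r big1 ?addr0// => w wv.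
    case: eqP => [kw|]; rewrite ?mulr0//; exfalso; move/eqP : wv; apply.
    by apply/ffunP => i; apply/val_inj; rewrite ffunE/= kw mxE.
  rewrite mul0r big1// => v _; case: eqP => [kv|]; rewrite ?mulr0//; exfalso.
  by move/negP : kb; apply; apply/forallP => i; rewrite kv mxE.
by apply: test_fun_sum => v; apply: test_funZ; exact: test_fun_point.
Qed.

Lemma Rintegral_box nu b : (\int[nu]_k (box b k)%:R)%R = fine (nu [set k | box b k]).
Proof.
rewrite -Rintegral_indicator; apply: eq_Rintegral => k _.
by rewrite indicE mem_setE.
Qed.

Lemma tight_box e : 0 < e -> exists b, 1 - (\int[mu]_k (box b k)%:R)%R <= e.
Proof.
move=> e0; pose F b := [set k : vec | box b k].
have : mu (F b) @[b --> \oo] --> mu (\bigcup_b F b).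
  apply: nondecreasing_cvg_mu => //.
  move=> b b' bb'; apply/subsetPset => k /forallP kb; apply/forallP => i.
  exact: leq_trans (kb i) bb'.
have -> : \bigcup_b F b = setT.
  apply/seteqP; split => // k _; exists (\max_i k ord0 i).+1 => //.
  by apply/forallP => i; rewrite ltnS (leq_bigmax i).
rewrite probability_setT => /fine_cvgP[_ /cvgrPdist_le/(_ _ e0)[b _ bP]].
exists b; rewrite Rintegral_box (le_trans (ler_norm _))//.
exact: (bP b (leqnn b)).
Qed.

(** Truncated to a large box, [f] is a finite combination of point indicators.
    What is cut off is controlled by the mass outside the box, small for [mu]
    and hence, the indicator of the box being a test function, for [mu_ n]. *)
Theorem pgf_continuity f : bounded_fun f ->
  (\int[mu_ n]_k f k)%R @[n --> \oo] --> (\int[mu]_k f k)%R.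
Proof.
move=> bf; suff [] : test_fun f by [].
have [M fM] := bf.
have M0 : 0 <= M := le_trans (normr_ge0 _) (fM 0).
have bbox b : bounded_fun (fun k => (box b k)%:R).
  by exists 1 => k; case: (box b k); rewrite ?normr1 ?normr0.
split => //; apply/cvgrPdist_le => e e0.
pose e1 := e / (4 * (M + 1)).
have M1 : 0 < M + 1 by rewrite ltr_wpDl.
have e10 : 0 < e1 by rewrite divr_gt0// mulr_gt0.
have [b bP] := tight_box e10.
pose f1 k := (box b k)%:R * f k.
have [bf1 cf1] : test_fun f1 := test_fun_box b f.
have [_ cb] : test_fun (fun k => (box b k)%:R).
  by apply: eq_test_fun (test_fun_box b (fun=> 1)) => k; rewrite mulr1.
have tail nu : `|(\int[nu]_k f k)%R - (\int[nu]_k f1 k)%R| <=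
    M * (1 - (\int[nu]_k (box b k)%:R)%R).
  have bN g : bounded_fun g -> bounded_fun (fun k => -1 * g k).
    by move=> bg; apply: bounded_funM => //; exact: bounded_fun_cst.
  rewrite -{1}(Rintegral_prob_cst nu 1).
  rewrite -[X in _ * (_ - X)]mul1r -mulNr -bounded_RintegralZl//.
  rewrite -[X in `|_ - X|]mul1r -mulNr -bounded_RintegralZl//.
  rewrite -!bounded_RintegralD//; try exact: bN; last exact: bounded_fun_cst.
  rewrite -bounded_RintegralZl//; last first.
    by apply: bounded_funD; [exact: bounded_fun_cst|exact: bN].
  apply: le_norm_Rintegral.
  - by apply: bounded_funD => //; exact: bN.
  - apply: bounded_funM; first exact: bounded_fun_cst.
    by apply: bounded_funD; [exact: bounded_fun_cst|exact: bN].
  - move=> k; rewrite /f1 !mulN1r; case: (box b k).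
      by rewrite mul1r !subrr normr0 mulr0.
    by rewrite mul0r !subr0 mulr1.
near=> n.
have f1n : `|(\int[mu]_k f1 k)%R - (\int[mu_ n]_k f1 k)%R| <= e1.
  by near: n; move/cvgrPdist_le : cf1; exact.
have bn : `|(\int[mu]_k (box b k)%:R)%R - (\int[mu_ n]_k (box b k)%:R)%R| <= e1.
  by near: n; move/cvgrPdist_le : cb; exact.
have tailn : `|(\int[mu_ n]_k f k)%R - (\int[mu_ n]_k f1 k)%R| <= M * (2 * e1).
  rewrite (le_trans (tail _))// ler_wpM2l//.
  by move: bn; rewrite ler_norml => /andP[? ?]; lra.
have tail0 : `|(\int[mu]_k f k)%R - (\int[mu]_k f1 k)%R| <= M * e1.
  by rewrite (le_trans (tail _))// ler_wpM2l.
have eE : e = 4 * (M * e1) + 4 * e1 by rewrite /e1; field; rewrite gt_eqF.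
have Me1 : 0 <= M * e1 by rewrite mulr_ge0// ltW.
rewrite mulrCA in tailn.
move: f1n tailn tail0; rewrite !ler_norml.
move=> /andP[? ?] /andP[? ?] /andP[? ?]; apply/andP; split; lra.
Unshelve. all: by end_near. Qed.

End pgf_continuity.

(** * Partition by the values of a discrete random variable *)

Section fibers.
Context {dT : measure_display} {T : measurableType dT} {R : realType}
  {C : countType}.
Variables (P : {measure set T -> \bar R}) (Y : T -> C).
Hypothesis mY : forall k, measurable [set w | Y w = k].
Local Open Scope ereal_scope.

(** Indexing by codes instead of values makes the partition a sequence of sets, as
    countable additivity requires; a number that is no code gives the empty set. *)
Definition fiber n := [set w | choice.pickle (Y w) = n].

Lemma fiber_pickle k : fiber (choice.pickle k) = [set w | Y w = k].
Proof.
apply/seteqP; split => w /=; first exact: (pcan_inj (@choice.pickleK C)).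
by move=> Ywk; rewrite /fiber /= Ywk.
Qed.

Lemma fiberP n : fiber n = set0 \/
  exists2 k, n = choice.pickle k & fiber n = [set w | Y w = k].
Proof.
have [[w wn]|] := pselect (fiber n !=set0); last first.
  by move/set0P/negP/negbNE/eqP; left.
by right; exists (Y w) => //; rewrite -wn fiber_pickle.
Qed.

Lemma measurable_fiber n : measurable (fiber n).
Proof. by have [->|[k _ ->]] := fiberP n. Qed.

Lemma trivIset_fiber : trivIset setT fiber.
Proof. by move=> i j _ _ [w [<- <-]]. Qed.

Lemma bigcup_fiber : \bigcup_n fiber n = setT.
Proof. by apply/seteqP; split => // w _; exists (choice.pickle (Y w)). Qed.

Lemma bigcup_setI_fiber E : \bigcup_n (E `&` fiber n) = E.
Proof. by rewrite -setI_bigcupr bigcup_fiber setIT. Qed.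

Lemma trivIset_setI_fiber E : trivIset setT (fun n => E `&` fiber n).
Proof. by move=> i j _ _ [w [[_ <-] [_ <-]]]. Qed.

Lemma ge0_integral_fiber E (f : T -> \bar R) : measurable E ->
  measurable_fun E f -> (forall w, 0 <= f w) ->
  \int[P]_(w in E) f w = \sum_(n <oo) \int[P]_(w in E `&` fiber n) f w.
Proof.
move=> mE mf f0; rewrite -{1}(bigcup_setI_fiber E) ge0_integral_bigcup//.
- by move=> n; apply: measurableI => //; exact: measurable_fiber.
- by rewrite bigcup_setI_fiber.
- exact: trivIset_setI_fiber.
Qed.

End fibers.

(** * Events independent of a family of random vectors *)

Section independence_of_event.
Context {dT : measure_display} {T : measurableType dT} {R : realType}
  {d : nat} {I : choiceType}.
Variables (P : probability T R) (V : I -> {RV P >-> 'rV[nat]_d}).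
Implicit Types (E : set T) (D : set I).
Local Open Scope ereal_scope.

(** [E] is independent of the sigma-algebra generated by [V i] for [i] in [D];
    the test on finite intersections of preimages avoids that sigma-algebra. *)
Definition indep_event E D := measurable E /\
  forall (J : {fset I}) (A : I -> set 'rV[nat]_d), [set` J] `<=` D ->
    P (E `&` \bigcap_(i in [set` J]) (V i @^-1` A i)) =
    P E * \prod_(i <- J) P (V i @^-1` A i).

Lemma indep_eventS E D D' : D' `<=` D -> indep_event E D -> indep_event E D'.
Proof.
by move=> DD' [mE EP]; split => // J A JD; apply: EP; exact: subset_trans DD'.
Qed.

Lemma measurable_preimage_vec i (A : set 'rV[nat]_d) : measurable (V i @^-1` A).
Proof. by rewrite -[X in measurable X]setTI; exact: measurable_funPT. Qed.

Lemma indep_event_preimage E D i A : D i -> indep_event E D ->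
  P (E `&` V i @^-1` A) = P E * P (V i @^-1` A).
Proof.
move=> Di [_ /(_ [fset i]%fset (fun=> A))].
rewrite big_seq_fset1 (_ : [set` [fset i]%fset] = [set i]); last first.
  by apply/seteqP; split => j /=; rewrite inE => /eqP.
by rewrite bigcap_set1; apply => j ->.
Qed.

(** Conditioning on [V i] uses up the index [i] but keeps the independence of
    the other ones. *)
Lemma indep_event_setI E D i A : D i -> indep_event E D ->
  indep_event (E `&` V i @^-1` A) (D `\ i).
Proof.
move=> Di iE; have [mE EP] := iE; split.
  by apply: measurableI => //; exact: measurable_preimage_vec.
move=> J B JD.
have iJ : i \notin J by apply/negP => /JD [_]; exact.
pose B' j := if j == i then A else B j.
rewrite (indep_event_preimage _ Di iE) -muleA.
have BE j : j \in J -> B' j = B j.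
  by move=> jJ; rewrite /B'; case: eqP => // ji; rewrite -ji jJ in iJ.
have := EP (i |` J)%fset B'; rewrite big_fsetU1//= {2}/B' eqxx.
rewrite (eq_big_seq (fun j => P (V j @^-1` B j))); last first.
  by move=> j jJ /=; rewrite BE.
move=> <-.
  congr (P _); rewrite -setIA; congr (_ `&` _); apply/seteqP; split => w.
    move=> [wA wB] j /=; rewrite !inE => /orP[/eqP ->|jJ]; first by rewrite /B' eqxx.
    by rewrite BE//; exact: wB.
  move=> wB; split=> [|j jJ].
    by have := wB i; rewrite /= /B' eqxx; apply; rewrite !inE eqxx.
  by have := wB j; rewrite /= BE//; apply; rewrite !inE jJ orbT.
by move=> j /=; rewrite !inE => /orP[/eqP ->//|/JD[]].
Qed.

(** For a fixed finite intersection, both sides of the product rule are countably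
    additive in the event. *)
Lemma indep_event_bigcup (G : nat -> set T) D : trivIset setT G ->
  (forall n, indep_event (G n) D) -> indep_event (\bigcup_n G n) D.
Proof.
move=> tG iG; split; first by apply: bigcupT_measurable => n; have [] := iG n.
move=> J A JD; set C := \bigcap_(i in _) _.
have mC : measurable C.
  apply: fin_bigcap_measurable => // i _; exact: measurable_preimage_vec.
rewrite setI_bigcupl measure_bigcup//.
- rewrite measure_bigcup//; last by move=> n _; have [] := iG n.
  rewrite [RHS]muleC.
  have [c0 cf] : 0 <= \prod_(i <- J) P (V i @^-1` A i) /\
      \prod_(i <- J) P (V i @^-1` A i) \is a fin_num.
    split; first by apply: prode_ge0.
    apply: prode_fin_num => i _.
    exact: fin_num_measure (measurable_preimage_vec _ _).
  rewrite -(fineK cf) -nneseriesZl//.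
  by apply: eq_eseriesr => n _; rewrite fineK// muleC; have [_] := iG n; apply.
- by move=> n _; apply: measurableI => //; have [] := iG n.
- exact: trivIset_setIr.
Qed.

Lemma indep_event_fiberwise {C : countType} (Y : T -> C) E D :
  (forall k, indep_event (E `&` [set w | Y w = k]) D) -> indep_event E D.
Proof.
move=> iE; rewrite -(bigcup_setI_fiber Y E).
apply: indep_event_bigcup; first exact: trivIset_setI_fiber.
move=> n; have [->|[k _ ->]] := fiberP Y n; last exact: iE.
rewrite setI0; split => // J A _; by rewrite set0I measure0 mul0e.
Qed.

Definition partial_sum (l : seq I) w : 'rV[nat]_d := (\sum_(i <- l) V i w)%R.

(** By induction on [l]: on each event [V i = v] the sum over [i :: l] is [v] plus
    the sum over [l], and conditioning on [V i = v] costs only the index [i]. *)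
Lemma indep_event_partial_sum (l : seq I) E D (K : set 'rV[nat]_d) :
  uniq l -> [set` l] `<=` D -> indep_event E D ->
  indep_event (E `&` partial_sum l @^-1` K) (D `\` [set` l]).
Proof.
elim: l E D K => [|i l IH] E D K /=.
  move=> _ _ iE.
  have -> : D `\` [set` [::]] = D by apply/seteqP; split => // x [].
  have [K0|K0] := pselect (K 0%R).
    have -> : partial_sum [::] @^-1` K = setT.
      by apply/seteqP; split => // w _; rewrite /partial_sum /= big_nil.
    by rewrite setIT.
  have -> : partial_sum [::] @^-1` K = set0.
    by apply/seteqP; split => // w; rewrite /partial_sum /= big_nil.
  rewrite setI0.
  by split => // J A _; rewrite set0I measure0 mul0e.
move=> /andP[il ul] lD iE.
have Di : D i by apply: lD; rewrite /= mem_head.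
apply: (@indep_event_fiberwise _ (V i)) => v.
have -> : E `&` partial_sum (i :: l) @^-1` K `&` [set w | V i w = v] =
    E `&` V i @^-1` [set v] `&` partial_sum l @^-1` [set u | K (v + u)%R].
  apply/seteqP; split => w /=; rewrite /partial_sum big_cons.
    by move=> [[Ew Kw] <-].
  by move=> [[Ew ->] Kw].
have -> : D `\` [set` i :: l] = D `\ i `\` [set` l].
  apply/seteqP; split => j /=; rewrite inE.
    by move=> [Dj /negP]; rewrite negb_or => /andP[/eqP ? /negP].
  by move=> [[Dj /= /eqP/negbTE ->] ?].
apply: IH => //; last exact: indep_event_setI.
move=> j jl; split; first by apply: lD; rewrite /= inE jl orbT.
by move=> /= ji; move: jl; rewrite /= ji => jl; rewrite jl in il.
Qed.

End independence_of_event.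

Section pgf_partial_sum.
Context {dT : measure_display} {T : measurableType dT} {R : realType}
  {d : nat} {I : choiceType}.
Variables (P : probability T R) (V : I -> {RV P >-> 'rV[nat]_d}).
Local Open Scope ereal_scope.

Lemma measurable_partial_sum (l : seq I) (K : set 'rV[nat]_d) :
  measurable (partial_sum V l @^-1` K).
Proof.
elim: l K => [|i l IH] K.
  have [K0|K0] := pselect (K 0%R).
    have -> : partial_sum V [::] @^-1` K = setT; last exact: measurableT.
    by apply/seteqP; split => // w _; rewrite /partial_sum /= big_nil.
  have -> : partial_sum V [::] @^-1` K = set0; last exact: measurable0.
  by apply/seteqP; split => // w; rewrite /partial_sum /= big_nil.
rewrite -(bigcup_setI_fiber (V i) (_ @^-1` _)).
apply: bigcupT_measurable => n.
have [->|[v _ ->]] := fiberP (V i) n; first by rewrite setI0; exact: measurable0.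
rewrite (_ : _ `&` _ =
    V i @^-1` [set v] `&` partial_sum V l @^-1` [set u | K (v + u)%R]).
  by apply: measurableI; [exact: measurable_preimage_vec|exact: IH].
apply/seteqP; split => w /=; rewrite /partial_sum big_cons.
  by move=> [Kw <-].
by move=> [->].
Qed.

Lemma measurable_EFin_vec (Y : T -> 'rV[nat]_d) (h : 'rV[nat]_d -> R) E :
  (forall K, measurable (Y @^-1` K)) -> measurable_fun E (fun w => (h (Y w))%:E).
Proof.
move=> mY; apply/measurable_EFinP; apply: measurable_funTS => _ B _.
by rewrite setTI; exact: (mY (h @^-1` B)).
Qed.

(** Monomials being multiplicative, independence makes the integral over [E]
    factor; the summands are split off one at a time, by conditioning on the
    value of the first one. *)
Lemma integral_monomial_partial_sum (s : 'I_d -> R) (q : I -> R) (l : seq I) E D :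
  (forall i, 0 <= s i)%R ->
  uniq l -> [set` l] `<=` D -> indep_event V E D ->
  (forall i, i \in l -> \int[P]_w (monomial s (V i w))%:E = (q i)%:E) ->
  \int[P]_(w in E) (monomial s (partial_sum V l w))%:E =
    P E * (\prod_(i <- l) q i)%:E.
Proof.
move=> s0; elim: l E D => [|i l IH] E D.
  move=> _ _ [mE _] _; rewrite big_nil mule1.
  under eq_integral do rewrite /partial_sum big_nil monomial0.
  by rewrite integral_cst// mul1e.
move=> /= /andP[il ul] lD iE qP; have [mE _] := iE.
have Di : D i by apply: lD; rewrite /= mem_head.
have PEf : P E \is a fin_num by exact: fin_num_measure.
have mVi v : measurable [set w | V i w = v].
  exact: (measurable_preimage_vec V i [set v]).
have mS l' A : measurable_fun A (fun w => (monomial s (partial_sum V l' w))%:E).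
  by apply: measurable_EFin_vec => K; exact: measurable_partial_sum.
have mono0 v : 0 <= (monomial s v)%:E by rewrite lee_fin monomial_ge0.
have q0 j : j \in i :: l -> (0 <= q j)%R.
  by move=> jl; rewrite -lee_fin -qP// integral_ge0.
rewrite (ge0_integral_fiber _ mVi)//.
rewrite big_cons EFinM [in RHS]muleCA -qP ?mem_head// muleC.
have c0 : (0 <= fine (P E) * \prod_(j <- l) q j)%R.
  rewrite mulr_ge0 ?fine_ge0// big_seq prodr_ge0// => j jl.
  by rewrite q0// inE jl orbT.
rewrite -(fineK PEf) -EFinM (ge0_integral_fiber _ mVi)//; last first.
  by apply: measurable_EFin_vec => K; exact: measurable_preimage_vec.
rewrite -nneseriesZl//; last by move=> n _; exact: integral_ge0.
apply: eq_eseriesr => n _; rewrite setTI.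
have [->|[v _ Fv]] := fiberP (V i) n.
  by rewrite setI0 !integral_set0 mule0.
rewrite Fv.
have iEv := indep_event_setI [set v] Di iE.
rewrite (eq_integral (fun w =>
    (monomial s v)%:E * (monomial s (partial_sum V l w))%:E)); last first.
  move=> w; rewrite inE => -[_ Vw].
  by rewrite /partial_sum big_cons Vw monomialD EFinM.
rewrite ge0_integralZl//=; last exact: measurableI.
rewrite (IH _ (D `\ i))//.
- rewrite [in RHS](eq_integral (fun w => (monomial s v)%:E)); last first.
    by move=> w; rewrite inE => ->.
  have PEv : P (E `&` [set w | V i w = v]) = P E * P [set w | V i w = v].
    exact: (indep_event_preimage [set v] Di iE).
  rewrite integral_cst//= PEv.
  by rewrite EFinM fineK// [RHS]muleCA; congr (_ * _); rewrite muleAC.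
- move=> j jl; split; first by apply: lD; rewrite /= inE jl orbT.
  by move=> ji; move: jl; rewrite /= ji => jl; rewrite jl in il.
- by move=> j jl; apply: qP; rewrite inE jl orbT.
Qed.

End pgf_partial_sum.

(** * Generating functions of Bernoulli and Poisson laws *)

Section pgf_of_laws.
Context {R : realType} {d : nat}.
Notation vec := 'rV[nat]_d.
Implicit Types (nu : probability vec R) (f : vec -> R).

Definition unit_vec (i : 'I_d) : vec := delta_mx ord0 i.

Lemma unit_vec_neq0 i : unit_vec i != 0.
Proof. by apply/eqP => /rowP/(_ i); rewrite !mxE !eqxx. Qed.

Lemma unit_vec_inj : injective unit_vec.
Proof.
by move=> i j /rowP/(_ i); rewrite !mxE !eqxx /=; case: eqVneq.
Qed.

Lemma Be_unit_vec (p : 'rV[R]_d) i : Be p [set unit_vec i] = (p ord0 i)%:E.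
Proof.
rewrite /Be (bigD1 i)//= big1 => [|j ji]; rewrite !diracE.
  rewrite mem_set// mule1 memNset; first by rewrite mule0 !adde0.
  by move=> /= /esym/eqP; apply/negP; exact: unit_vec_neq0.
rewrite memNset ?mule0// => /= /unit_vec_inj /eqP; exact/negP.
Qed.

Lemma Be_0 (p : 'rV[R]_d) : Be p [set 0] = (1 - \sum_(i < d) p ord0 i)%:E.
Proof.
rewrite /Be big1 => [|j _]; rewrite diracE.
  by rewrite mem_set// mule1 add0e.
by rewrite memNset ?mule0// => /= /eqP; apply/negP; exact: unit_vec_neq0.
Qed.

Lemma Be_law_subprobability nu p : (forall A, nu A = Be p A) -> subprobability p.
Proof.
move=> nuB; split => [i|].
  by rewrite -lee_fin -Be_unit_vec -nuB measure_ge0.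
by rewrite -subr_ge0 -lee_fin -Be_0 -nuB measure_ge0.
Qed.

(** A law of this form is carried by 0 and the unit vectors, so [f] may be
    replaced by a combination of the indicators of these points. *)
Lemma Rintegral_Be nu p f : (forall A, nu A = Be p A) -> bounded_fun f ->
  (\int[nu]_k f k)%R = \sum_i p ord0 i * f (unit_vec i)
    + (1 - \sum_i p ord0 i) * f 0.
Proof.
move=> nuB bf; pose rest := [set k : vec | k != 0 /\ forall i, k != unit_vec i].
have bZ (c : R) (A : set vec) : bounded_fun (fun k => c * \1_A k).
  by apply: bounded_funM; [exact: bounded_fun_cst|exact: bounded_fun_indic].
have rest0 : (\int[nu]_k (f k * \1_rest k))%R = 0.
  have [M fM] := bf.
  apply/normr0_eq0/eqP; rewrite eq_le normr_ge0 andbT.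
  apply: (@le_trans _ _ (\int[nu]_k (M * \1_rest k))%R).
    apply: le_norm_Rintegral; [|exact: bZ|].
      by apply: bounded_funM => //; exact: bounded_fun_indic.
    by move=> k; rewrite normrM (@ger0_norm _ (\1_rest k))// ler_wpM2r.
  rewrite bounded_RintegralZl; last exact: bounded_fun_indic.
  rewrite Rintegral_indicator nuB /Be big1 => [|j _]; rewrite diracE memNset.
  - by rewrite mule0 adde0 mulr0.
  - by move=> [/eqP].
  - by rewrite mule0.
  - by move=> [_ /(_ j)/eqP].
have fE k : f k = \sum_i f (unit_vec i) * \1_[set unit_vec i] k
    + (f 0 * \1_[set 0] k + f k * \1_rest k).
  have [[i ->]|kN] := pselect (exists i, k = unit_vec i).
    rewrite (bigD1 i)//= !indicE mem_set// mulr1 big1 => [|j ji].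
      rewrite memNset; last by move=> /= /eqP; apply/negP; exact: unit_vec_neq0.
      by rewrite memNset ?mulr0 ?addr0// => -[_ /(_ i)/eqP].
    by rewrite indicE memNset ?mulr0// => /= /unit_vec_inj/esym/eqP; exact/negP.
  rewrite big1 ?add0r => [|j _]; last first.
    by rewrite indicE memNset ?mulr0// => /= kj; apply: kN; exists j.
  have [->|k0] := eqVneq k 0.
    by rewrite !indicE mem_set// memNset ?mulr0 ?mulr1 ?addr0// => -[/eqP].
  rewrite !indicE memNset; last exact/eqP.
  rewrite mem_set ?mulr0 ?mulr1 ?add0r//; split => // i.
  by apply/eqP => ki; apply: kN; exists i.
under eq_Rintegral do rewrite fE.
rewrite bounded_RintegralD//; first last.
- apply: bounded_funD => //; apply: bounded_funM => //; exact: bounded_fun_indic.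
- exact: bounded_fun_sum.
rewrite bounded_RintegralD//; last first.
  by apply: bounded_funM => //; exact: bounded_fun_indic.
rewrite rest0 addr0 bounded_Rintegral_sum//.
rewrite bounded_RintegralZl; last exact: bounded_fun_indic.
rewrite Rintegral_indicator nuB Be_0 mulrC; congr (_ + _).
apply: eq_bigr => i _; rewrite bounded_RintegralZl; last exact: bounded_fun_indic.
by rewrite Rintegral_indicator nuB Be_unit_vec mulrC.
Qed.

Lemma monomial_unit_vec (s : 'I_d -> R) i : monomial s (unit_vec i) = s i.
Proof.
rewrite /monomial (bigD1 i)//= big1 => [|j /negbTE ji].
  by rewrite mxE !eqxx expr1 mulr1.
by rewrite mxE ji andbF.
Qed.

Lemma pgf_Be nu p (s : 'I_d -> R) : (forall A, nu A = Be p A) ->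
  (forall i, 0 <= s i <= 1) ->
  (\int[nu]_k monomial s k)%R = 1 - \sum_i p ord0 i * (1 - s i).
Proof.
move=> nuB sP; rewrite (Rintegral_Be nuB (bounded_monomial sP)) monomial0 mulr1.
under eq_bigr do rewrite monomial_unit_vec.
under [in RHS]eq_bigr do rewrite mulrBr mulr1.
by rewrite sumrB; ring.
Qed.

(** Tilting: weighting the Poisson mass at [n] by [s ^+ n] gives, up to a
    constant, the mass of the Poisson law whose rate is multiplied by [s]. *)
Lemma poisson_tilt (s r : R) n : 0 < s -> 0 <= r ->
  ((s ^+ n)%:E * poisson_prob r 0 [set n] =
   (expR (- (r * (1 - s))))%:E * poisson_prob (s * r) 0 [set n])%E.
Proof.
move=> s0; rewrite le_eqVlt => /orP[/eqP <-|r0].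
  rewrite mulr0 mul0r oppr0 expR0 mul1e /poisson_prob ltxx diracE.
  have [n0|n0] := eqVneq n 0%N; first by rewrite n0 expr0 mul1e.
  by rewrite memNset ?mule0// => /= /esym/eqP; exact/negP.
rewrite /poisson_prob r0 mulr_gt0// !esum_set1 ?lee_fin ?poisson_pmf_ge0//.
rewrite -!EFinM /poisson_pmf r0 mulr_gt0//; congr EFin.
rewrite exprMn (_ : - r = - (r * (1 - s)) + - (s * r)); last by ring.
by rewrite expRD; ring.
Qed.

(** By [poisson_tilt] the integrand turns [Po mu] into a constant times another
    Poisson law, whose total mass is 1. *)
Lemma pgf_Po (mu : 'rV[R]_d) (s : 'I_d -> R) :
  (forall i, 0 <= mu ord0 i) -> (forall i, 0 < s i) ->
  (\int[Po mu]_k (monomial s k)%:E =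
   (expR (- \sum_i mu ord0 i * (1 - s i)))%:E)%E.
Proof.
move=> mu0 s0.
pose mu' : 'rV[R]_d := \row_i (s i * mu ord0 i).
have mk (k : vec) : measurable [set w : vec | w = k] by [].
rewrite (ge0_integral_fiber _ mk)//; last first.
  by move=> k; rewrite lee_fin monomial_ge0// => i; exact: ltW.
pose c := expR (- \sum_i mu ord0 i * (1 - s i)).
have pt k : ((monomial s k)%:E * Po mu [set k] = c%:E * Po mu' [set k])%E.
  rewrite /Po !esum_set1; last 2 first.
  - exact: Po_mass_ge0.
  - exact: Po_mass_ge0.
  rewrite /c -sumrN expR_sum /monomial -!prodEFin -!big_split/=.
  by apply: eq_bigr => i _; rewrite mxE poisson_tilt.
rewrite (eq_eseriesr (g := fun n =>
    (c%:E * Po mu' (fiber (fun k : vec => k) n))%E)); last first.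
  move=> n _; rewrite setTI.
  have [->|[k _ ->]] := fiberP (fun k : vec => k) n.
    by rewrite integral_set0 measure0 mule0.
  rewrite (eq_integral (fun=> (monomial s k)%:E)); last first.
    by move=> w; rewrite inE => ->.
  by rewrite integral_cst// -pt.
rewrite nneseriesZl//.
rewrite -measure_semi_bigcup//; last exact: trivIset_fiber.
rewrite bigcup_fiber -[RHS]mule1; congr (_ * _)%E.
exact: (probability_setT (Po mu')).
Qed.

End pgf_of_laws.

(** * The law of a GWI process with Bernoulli offspring and immigration *)

Section gwi_pgf.
Context {dT : measure_display} {T : measurableType dT} {R : realType}.
Variables (P : probability T R) (d : nat).
Variables (xi : nat -> nat -> 'I_d -> {RV P >-> 'rV[nat]_d})
  (eps : nat -> {RV P >-> 'rV[nat]_d}) (B : nat -> 'M[R]_d)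
  (m : nat -> 'rV[R]_d) (X : nat -> T -> 'rV[nat]_d).
Hypotheses (gwiX : gwi_process xi eps B m X)
  (bernoulli_xi : bernoulli_offspring xi B)
  (bernoulli_eps : bernoulli_immigration eps m).

Let V := gwi_family xi eps.

Definition generations_after (n : nat) : set (nat * nat * 'I_d + nat) :=
  [set k | match k with
           | inl (g, j, _) => (n < g)%N && (0 < j)%N
           | inr g => (n < g)%N
           end].

Definition summands (n : nat) (k : 'rV[nat]_d) : seq (nat * nat * 'I_d + nat) :=
  [seq inl (n, j, i) | i <- index_enum 'I_d, j <- index_iota 1 (k ord0 i).+1]
    ++ [:: inr n].

Lemma gwi_step_partial_sum n w :
  X n.+1 w = partial_sum V (summands n.+1 (X n w)) w.
Proof.
rewrite (gwi_step gwiX)// /partial_sum /summands big_cat big_seq1 /=.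
by rewrite big_allpairs_dep.
Qed.

Lemma uniq_summands n k : uniq (summands n k).
Proof.
rewrite cat_uniq/= orbF andbT; apply/andP; split.
  apply: allpairs_uniq_dep => [|i _|].
  - exact: index_enum_uniq.
  - exact: iota_uniq.
  - by move=> [i j] [i' j'] _ _ /= [-> ->].
by apply/negP => /allpairsPdep[i [j []]].
Qed.

Lemma summands_generation n k : [set` summands n.+1 k] `<=` generations_after n.
Proof.
move=> x /=; rewrite mem_cat => /orP[/allpairsPdep[i [j [_ + ->]]]|].
  by rewrite mem_index_iota => /andP[j0 _]; rewrite /= ltnSn.
by rewrite inE => /eqP ->; exact: ltnSn.
Qed.

Lemma generations_afterS n k :
  generations_after n.+1 `<=` generations_after n `\` [set` summands n.+1 k].
Proof.
move=> x xn; split.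
  by move: x xn => [[[g j] i]|g] /=; [move=> /andP[/ltnW -> ->]|exact: ltnW].
move=> /=; rewrite mem_cat inE => /orP[/allpairsPdep[i [j [_ _ xE]]]|/eqP xE].
  by move: xn; rewrite xE /= ltnn.
by move: xn; rewrite xE /= ltnn.
Qed.

(** [X n] is built from the offspring and the immigration of the generations
    up to [n]; the induction conditions on the value of [X n], which turns the
    random number of summands into a deterministic one. *)
Lemma gwi_indep_later n k : indep_event V [set w | X n w = k] (generations_after n).
Proof.
elim: n k => [|n IH] k.
  have iT : indep_event V setT (generations_after 0).
    split => // J A JD; rewrite setTI probability_setT mul1e.
    by apply: (gwi_independent gwiX).
  have [->|k0] := eqVneq k 0.
    rewrite (_ : [set _ | _] = setT)//.
    by apply/seteqP; split => // w _ /=; exact: gwi_init gwiX w.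
  rewrite (_ : [set _ | _] = set0).
    by split => // J A _; rewrite set0I measure0 mul0e.
  apply/seteqP; split => // w /=; rewrite (gwi_init gwiX) => kE.
  by rewrite kE eqxx in k0.
apply: (indep_event_fiberwise (Y := X n)) => x.
have -> : [set w | X n.+1 w = k] `&` [set w | X n w = x] =
    [set w | X n w = x] `&` partial_sum V (summands n.+1 x) @^-1` [set k].
  apply/seteqP; split => w /=.
    by move=> [<- <-]; rewrite -gwi_step_partial_sum.
  by move=> [<- <-]; rewrite -gwi_step_partial_sum.
apply: indep_eventS (generations_afterS x) _.
apply: indep_event_partial_sum; [exact: uniq_summands|exact: summands_generation|].
exact: IH.
Qed.

Lemma measurable_gwi n (K : set 'rV[nat]_d) : measurable (X n @^-1` K).
Proof.
rewrite -(bigcup_setI_fiber (X n) (_ @^-1` _)); apply: bigcupT_measurable => r.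
have [->|[v _ ->]] := fiberP (X n) r; first by rewrite setI0; exact: measurable0.
have [mv _] := gwi_indep_later n v.
have [Kv|Kv] := pselect (K v).
  by rewrite setIidr// => w /= ->.
rewrite (_ : _ `&` _ = set0); first exact: measurable0.
by apply/seteqP; split => // w /= [] /[swap] ->.
Qed.

Lemma offspring_law n j i A : (0 < n)%N -> (0 < j)%N ->
  distribution P (xi n j i) A = Be (row i (B n)) A.
Proof. by move=> n0 j0; rewrite (gwi_offspring_id gwiX)// bernoulli_xi. Qed.

Lemma offspring_subprobability n i : (0 < n)%N -> subprobability (row i (B n)).
Proof.
move=> n0; apply: (@Be_law_subprobability _ _ (distribution P (xi n 1%N i))) => A.
exact: offspring_law.
Qed.

Lemma immigration_subprobability n : (0 < n)%N -> subprobability (m n).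
Proof.
move=> n0; apply: (@Be_law_subprobability _ _ (distribution P (eps n))) => A.
exact: bernoulli_eps.
Qed.

Lemma integral_monomial_Be (Y : {RV P >-> 'rV[nat]_d}) p (t : 'cV[R]_d) :
  (forall A, distribution P Y A = Be p A) -> (forall i, 0 <= t i ord0 <= 1) ->
  (\int[P]_w (monomial (fun i => 1 - t i ord0) (Y w))%:E =
   (1 - (p *m t) ord0 ord0)%:E)%E.
Proof.
move=> lawY tP; pose s (i : 'I_d) := 1 - t i ord0; rewrite -/s.
have sP i : 0 <= s i <= 1.
  by rewrite /s subr_ge0 lerBlDl lerDr andbC; exact: tP.
rewrite -(ge0_integral_distribution Y
    (f := fun k => (monomial s k)%:E))//; last first.
  by move=> k; rewrite lee_fin monomial_ge0// => i; have /andP[] := sP i.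
rewrite EFin_Rintegral; last exact: bounded_monomial.
rewrite (pgf_Be lawY)// mxE; congr (_ - _)%:E.
by apply: eq_bigr => i _; rewrite /s opprB addrC subrK.
Qed.

(** Evaluated at [1 - t], a Bernoulli generating function is affine in [t], so
    composing generations multiplies [t] by the mean matrices. *)
Lemma pgf_gwi n (t : 'cV[R]_d) : (forall i, 0 <= t i ord0 <= 1) ->
  (\int[P]_w (monomial (fun i => 1 - t i ord0) (X n w))%:E =
   (\prod_(1 <= j < n.+1) (1 - (m j *m mxprod B j n *m t) ord0 ord0))%:E)%E.
Proof.
elim: n t => [|n IH] t tP.
  rewrite big_geq//.
  under eq_integral do rewrite (gwi_init gwiX) monomial0.
  by rewrite integral_cst// mul1e; exact: probability_setT.
pose s (i : 'I_d) := 1 - t i ord0; rewrite -/s.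
have s0 i : 0 <= s i by rewrite subr_ge0; have /andP[] := tP i.
pose t' := B n.+1 *m t.
have t'P i : 0 <= t' i ord0 <= 1.
  by apply: substochastic_mulmx => // k; exact: offspring_subprobability.
have /andP[_ mt1] :=
  mul_subprobability_box (immigration_subprobability (ltn0Sn n)) tP.
have c0 : 0 <= 1 - (m n.+1 *m t) ord0 ord0.
  rewrite subr_ge0 (le_trans mt1)//.
  by have [] := immigration_subprobability (ltn0Sn n).
have mX k : measurable [set w | X n w = k] by exact: (measurable_gwi n [set k]).
have monoge0 (u : 'cV[R]_d) (Y : T -> 'rV[nat]_d) w :
    (forall i, 0 <= u i ord0 <= 1) ->
    (0 <= (monomial (fun i => 1 - u i ord0) (Y w))%:E)%E.
  move=> uP; rewrite lee_fin monomial_ge0// => i; rewrite subr_ge0.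
  by have /andP[] := uP i.
(* One generation: given [X n = k], the offspring contribute the monomial of [k]
   at [1 - t'], and the immigration an independent factor. *)
have -> : (\int[P]_w (monomial s (X n.+1 w))%:E =
    (1 - (m n.+1 *m t) ord0 ord0)%:E *
    \int[P]_w (monomial (fun i => 1 - t' i ord0)%R (X n w))%:E)%E.
  rewrite (ge0_integral_fiber P mX)//; last 2 first.
  - by apply: measurable_EFin_vec; exact: measurable_gwi.
  - by move=> w; exact: monoge0.
  rewrite [in RHS](ge0_integral_fiber P mX)//; last 2 first.
  - by apply: measurable_EFin_vec; exact: measurable_gwi.
  - by move=> w; exact: monoge0.
  rewrite -nneseriesZl//; last first.
    by move=> r _; apply: integral_ge0 => w _; exact: monoge0.
  apply: eq_eseriesr => r _; rewrite setTI.
  have [->|[k _ ->]] := fiberP (X n) r; first by rewrite !integral_set0 mule0.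
  rewrite (eq_integral (fun w =>
      (monomial s (partial_sum V (summands n.+1 k) w))%:E)); last first.
    by move=> w; rewrite inE => <-; rewrite gwi_step_partial_sum.
  pose q (x : nat * nat * 'I_d + nat) : R :=
    match x with
    | inl (_, _, i) => 1 - t' i ord0
    | inr _ => 1 - (m n.+1 *m t) ord0 ord0
    end.
  rewrite (integral_monomial_partial_sum (q := q) s0 (uniq_summands _ _)
    (@summands_generation _ _) (gwi_indep_later n k)); last first.
    move=> x; rewrite mem_cat => /orP[/allpairsPdep[i [j [_ + ->]]]|].
      rewrite mem_index_iota => /andP[j0 _].
      rewrite (@integral_monomial_Be _ (row i (B n.+1)))//=.
        by rewrite -row_mul mxE.
      by move=> A; exact: offspring_law.
    rewrite inE => /eqP ->.
    rewrite (@integral_monomial_Be _ (m n.+1))//= => A.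
    exact: bernoulli_eps.
  rewrite [in RHS](eq_integral (fun=>
      (monomial (fun i => 1 - t' i ord0) k)%:E)); last first.
    by move=> w; rewrite inE => <-.
  rewrite integral_cst// muleA -EFinM muleC; congr (_%:E * _)%E.
  rewrite /summands big_cat big_seq1/= big_allpairs_dep/= mulrC; congr (_ * _).
  by apply: eq_bigr => i _; rewrite /= big_const_nat subn1/= -Monoid.iteropE.
rewrite IH// -EFinM [in RHS]big_nat_recr//= mxprodnn mulmx1 mulrC; congr (_ * _)%:E.
apply: eq_big_nat => j /andP[_ jn].
by rewrite mxprod_recr// /t' !mulmxA.
Qed.

End gwi_pgf.

(** * Convergence to the Poisson law *)

Definition random_vector {dT : measure_display} {T : measurableType dT}
    {R : realType} (P : probability T R) {d : nat} (Y : T -> 'rV[nat]_d)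
    (mY : measurable_fun setT Y) : {RV P >-> 'rV[nat]_d} :=
  HB.pack_for {RV P >-> 'rV[nat]_d} Y (isMeasurableFun.Build _ _ _ _ Y mY).

Theorem theorem1 (R : realType) (d : nat) (d_gt0 : (0 < d)%N)
    (dT : measure_display) (T : measurableType dT) (P : probability T R)
    (xi : nat -> nat -> 'I_d -> {RV P >-> 'rV[nat]_d})
    (eps : nat -> {RV P >-> 'rV[nat]_d})
    (B : nat -> 'M[R]_d) (m : nat -> 'rV[R]_d)
    (X : nat -> T -> 'rV[nat]_d)
    (N : 'rV[R]_d -> R) (Blim A : 'M[R]_d) (lambda : 'rV[R]_d) :
  is_norm N ->
  gwi_process xi eps B m X ->
  bernoulli_offspring xi B ->
  bernoulli_immigration eps m ->
  (* (B1) *)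
  B n @[n --> \oo] --> Blim ->
  (* (B2) *)
  (exists n0 : nat, forall n : nat, (n0 <= n)%N ->
     opnorm N (B n) <= 1 /\ Blim - B n \in unitmx) ->
  (* (B3) *)
  (forall j : nat, opnorm N (mxprod B j n) @[n --> \oo] --> (0 : R)) ->
  (* (B4) *)
  (\sum_(1 <= j < n.+1) (Blim - B j) *m mxprod B j n) @[n --> \oo] --> A ->
  (* (B5) *)
  (exists C : R, forall n : nat,
     \sum_(1 <= j < n.+1) opnorm N ((Blim - B j) *m mxprod B j n) <= C) ->
  (* (M) *)
  (m n *m invmx (Blim - B n)) @[n --> \oo] --> lambda ->
  (forall i : 'I_d, 0 <= (lambda *m A) ord0 i) /\
  cvg_in_distribution P X (Po (lambda *m A)).
Proof.
move=> normN gwiX bernoulli_xi bernoulli_eps B_cvg [n0 B2] B3 B4 [C B5] lambda_cvg.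
have Bsub n i : (0 < n)%N -> subprobability (row i (B n)).
  exact: (offspring_subprobability gwiX bernoulli_xi).
have msub n : (0 < n)%N -> subprobability (m n).
  exact: (immigration_subprobability bernoulli_eps).
have unitB n : (n0 <= n)%N -> Blim - B n \in unitmx by move=> /B2[].
have lA0 i : 0 <= (lambda *m A) ord0 i.
  exact: (limit_mean_ge0 normN Bsub msub unitB B3 B4 B5 lambda_cvg).
split => // g _ [M gM].
have mX n : measurable_fun setT (X n).
  move=> _ K _; rewrite setTI; exact: (measurable_gwi gwiX).
pose Y n := random_vector P (mX n).
pose f (k : 'rV[nat]_d) := g (natvec k).
have bf : bounded_fun f by exists M => k; exact: gM.
have fE n : ('E_P[fun w => g (natvec (X n w))])%E =
    (\int[distribution P (Y n)]_k f k)%R%:E.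
  rewrite unlock -EFin_Rintegral// integral_distribution//.
  apply: measurable_bounded_integrable => //.
  - exact: (le_lt_trans (probability_le1 P measurableT) (ltry 1)).
  - apply/measurable_EFinP; apply: measurable_EFin_vec.
    exact: (measurable_gwi gwiX).
  - exists M; split=> [|M' MM' w _]; first exact: num_real.
    exact: le_trans (gM _) (ltW MM').
rewrite (_ : (fun n => _) =
    (fun n => (\int[distribution P (Y n)]_k f k)%R%:E)); last exact/funext.
rewrite EFin_Rintegral//.
apply: cvg_EFin; first exact: nearW.
apply: pgf_continuity => // s sP.
pose t : 'cV[R]_d := \col_i (1 - s i).
have tP i : 0 <= t i ord0 <= 1.
  by rewrite mxE; have /andP[? ?] := sP i; apply/andP; split; lra.
have sE : s = fun i => 1 - t i ord0.
  by apply/funext => i; rewrite mxE opprB addrC subrK.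
have sP' i : 0 <= s i <= 1 by have /andP[/ltW -> ->] := sP i.
have bs := bounded_monomial sP'.
have -> : (\int[Po (lambda *m A)]_k monomial s k)%R =
    expR (- (lambda *m A *m t) ord0 ord0).
  apply: EFin_inj; rewrite -EFin_Rintegral// pgf_Po//; last first.
    by move=> i; have /andP[] := sP i.
  congr (expR (- _))%:E; rewrite [RHS]mxE.
  by apply: eq_bigr => i _; rewrite [t _ _]mxE.
have := cvg_prod_pgf normN Bsub msub B_cvg unitB B3 B4 B5 lambda_cvg tP.
apply: cvg_trans; apply: near_eq_cvg; apply: nearW => n /=.
apply: EFin_inj.
rewrite -(pgf_gwi gwiX bernoulli_xi bernoulli_eps n tP) -EFin_Rintegral//.
rewrite ge0_integral_distribution//; last first.
  by move=> k; rewrite lee_fin monomial_ge0// => i; have /andP[] := sP' i.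
by rewrite -sE.
Qed.
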